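(* Let $R$ be a non-zero reduced order. Then there exist a stark ring $A$ and a finite abelian group $G$ such that $R\cong A[G]$ as rings. Moreover $A$ is unique up to ring isomorphism and $G$ is unique up to group isomorphism: if $B$ is a stark ring and $H$ is a finite abelian group with $R\cong B[H]$ as rings, then $B\cong A$ as rings and $H\cong G$ as groups.
   Context: All rings have a unit element. An order is a commutative ring whose additive group is isomorphic to $\mathbb{Z}^n$ for some $n\in\mathbb{Z}_{\geq 0}$. A commutative ring is reduced if it has no non-zero nilpotent elements. A commutative ring $R$ is called stark if there do not exist a ring $A$ and a non-trivial group $G$ such that $R$ is isomorphic to the group ring $A[G]$. *)

(* Defs.v *)
From Stdlib Require Import List.
From HB Require Import structures.
From mathcomp Require Import all_boot all_order all_algebra.
Set Implicit Arguments. Unset Strict Implicit. Unset Printing Implicit Defensive.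
Import GRing.Theory.
Local Open Scope ring_scope.

Record grp := Grp {
  gcar :> Type;
  gmul : gcar -> gcar -> gcar;
  gone : gcar;
  ginv : gcar -> gcar;
  gmulA : forall x y z, gmul x (gmul y z) = gmul (gmul x y) z;
  gmul1 : forall x, gmul gone x = x;
  gmulV : forall x, gmul (ginv x) x = gone }.
Arguments gmul {g}. Arguments gone {g}. Arguments ginv {g}.

Definition grp_nontrivial (G : grp) : Prop := exists g : G, g <> gone.

Definition fin_abelian (G : grp) : Prop :=
  (exists s : seq G, forall g : G, List.In g s) /\
  (forall x y : G, gmul x y = gmul y x).

Definition grp_iso (H G : grp) : Prop :=
  exists f : H -> G, bijective f /\ forall x y : H, f (gmul x y) = gmul (f x) (f y).

Definition ring_iso (A B : pzRingType) : Prop :=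
  exists f : A -> B, bijective f /\ f 1 = 1 /\
    (forall x y, f (x + y) = f x + f y) /\ (forall x y, f (x * y) = f x * f y).

(* Finitely supported functions G -> A: the underlying set of the group ring A[G]. *)
Definition fin_supp (A : pzRingType) (G : grp) (f : G -> A) : Prop :=
  exists s : seq G, forall g : G, f g != 0 -> List.In g s.

(* phi : R -> A[G] is a ring isomorphism, where A[G] is the set of finitely
   supported functions G -> A with pointwise addition, unit delta_1 and
   convolution product (f*h)(x) = sum_y f(y) h(y^-1 x). *)
Definition is_grpring_iso (R A : pzRingType) (G : grp) (phi : R -> G -> A) : Prop :=
  [/\ injective phi /\ (forall r, fin_supp (phi r)),
      (forall f : G -> A, fin_supp f -> exists r, phi r = f),
      (forall r s g, phi (r + s) g = phi r g + phi s g),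
      (phi 1 gone = 1 /\ forall g : G, g <> gone -> phi 1 g = 0) &
      (forall r t (s : seq G), List.NoDup s ->
         (forall g, phi r g != 0 -> List.In g s) ->
         forall x : G, phi (r * t) x = \sum_(y <- s) phi r y * phi t (gmul (ginv y) x))].

Definition grpring_iso (R A : pzRingType) (G : grp) : Prop :=
  exists phi : R -> G -> A, is_grpring_iso phi.

Definition stark (R : pzRingType) : Prop :=
  ~ exists (A : pzRingType) (G : grp), grp_nontrivial G /\ grpring_iso R A G.

Definition reduced (R : pzRingType) : Prop :=
  forall (x : R) (n : nat), x ^+ n = 0 -> x = 0.

Definition is_order (R : comPzRingType) : Prop :=
  exists (n : nat) (f : R -> 'rV[int]_n),
    bijective f /\ forall x y, f (x + y) = f x + f y.

(* Main.v *)
(* Existence: if R = A[G] then |G| is at most the rank of R, so a decomposition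
   with |G| maximal has A stark.

   Uniqueness rests on positivity.  R carries the Hermitian form
   <x, y> = sum over f of f(x) conj(f(y)), f running over the ring homomorphisms
   from R to the complex numbers; it is positive definite because R is reduced.
   The pieces of a grading of R by a finite abelian group are orthogonal, since
   a character of the group permutes the f, and multiplication by a root of unity
   is an isometry.  Orthogonal decompositions of a lattice commute, so any two
   gradings of R commute, idempotents have degree 1, and every root of unity is
   homogeneous up to a partition of unity into idempotents.

   Let R = A[C] = B[H] with C nontrivial and indecomposable.  On a piece of such
   a partition the degree maps a : C -> H and b : H -> C are homomorphisms, and
   every c in C is h = a(c) times a unit of B of degree c * b(a(c))^-1 for C.
   As C is indecomposable, either b o a or c |-> c * b(a(c))^-1 is injective.
   If the latter held on every piece, B would be a group ring over C; hence, B
   being stark, b o a is bijective on some piece and C is a direct factor of H.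
   It remains to cancel C: if R = A[C] = B[C], then on each piece the units above
   give an isomorphism of A with B, and these glue.  Now induct on |G|. *)
Require Import Defs.
From Stdlib Require List FinFun.
From HB Require Import structures.
From mathcomp Require Import all_boot all_order all_algebra.
From mathcomp Require Import all_fingroup all_field all_character boolp.
Set Implicit Arguments. Unset Strict Implicit. Unset Printing Implicit Defensive.
Import Order.TTheory GRing.Theory Num.Theory.
Local Open Scope ring_scope.

(** * Complex embeddings of a reduced order *)

Section AdditiveMap.
Variables (V W : zmodType) (f : V -> W).
Hypothesis fD : forall x y, f (x + y) = f x + f y.

Lemma additive_map0 : f 0 = 0.
Proof. by apply: (addrI (f 0)); rewrite -fD !addr0. Qed.

Lemma additive_mapN x : f (- x) = - f x.
Proof. by apply: (addrI (f x)); rewrite -fD !subrr additive_map0. Qed.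

Lemma additive_mapB x y : f (x - y) = f x - f y.
Proof. by rewrite fD additive_mapN. Qed.

Lemma additive_mapMz x (m : int) : f (x *~ m) = f x *~ m.
Proof.
case: m => k; rewrite ?NegzE ?mulrNz ?additive_mapN -!pmulrn; [|congr (- _)].
  by elim: k => [|k IH]; rewrite ?mulr0n ?additive_map0 // !mulrS fD IH.
by elim: k.+1 => [|j IH]; rewrite ?mulr0n ?additive_map0 // !mulrS fD IH.
Qed.

Lemma additive_map_sum (I : Type) (r : seq I) (Q : pred I) (F : I -> V) :
  f (\sum_(i <- r | Q i) F i) = \sum_(i <- r | Q i) f (F i).
Proof. exact: (big_morph f fD additive_map0). Qed.
End AdditiveMap.

Lemma additive_matrix m n (h : 'rV[int]_m -> 'rV[int]_n) :
  (forall x y, h (x + y) = h x + h y) ->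
  exists M : 'M[int]_(m, n), forall v, h v = v *m M.
Proof.
move=> hD; exists (\matrix_i h (delta_mx 0 i)) => v.
rewrite mulmx_sum_row {1}[v]row_sum_delta.
rewrite (additive_map_sum hD); apply: eq_bigr => i _.
by rewrite rowK -[v 0 i]intz !scaler_int (additive_mapMz hD).
Qed.

(** Dividing [p] by its gcd with its derivative keeps every root, once. Over [algC] each of the
    [(size p).-1] linear factors of [p] then divides [u], so the exponent [size p] suffices. *)
Lemma squarefree_part (p : {poly rat}) : p != 0 ->
  exists (u : {poly rat}) (k : nat),
    [/\ p %| u ^+ k, u != 0 & separable_poly u].
Proof.
move=> p0; set d := gcdp p p^`(); set u := p %/ d.
have pE : p = u * d by rewrite divpK ?dvdp_gcdl.
have u0 : u != 0 by apply: contraNneq p0 => u0; rewrite pE u0 mul0r.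
exists u, (size p); split=> //; last exact: make_separable.
pose f := @ratr algC; rewrite -(dvdp_map f) rmorphXn /=.
have fp0 : map_poly f p != 0 by rewrite map_poly_eq0.
have [rs rsE] := closed_field_poly_normal (map_poly f p).
(* If [r] were not a root of [u], the full power of ['X - r%:P] in [p] would divide [d], hence the
   derivative of [p]; this forces one more such factor into [p]. *)
have root_u r : root (map_poly f p) r -> root (map_poly f u) r.
  move=> pr; apply/negPn/negP => nur.
  have kpos : (0 < mup r (map_poly f p))%N.
    by rewrite mup_geq // expr1 dvdp_XsubCl.
  set k := mup r (map_poly f p) in kpos.
  have hk : ('X - r%:P) ^+ k %| map_poly f p by rewrite -mup_geq.
  have hd : ('X - r%:P) ^+ k %| map_poly f d.
    move: hk; rewrite pE rmorphM /= Gauss_dvdpr //.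
    by rewrite coprimep_expl // coprimep_sym coprimep_XsubC.
  have : ('X - r%:P) ^+ k %| (map_poly f p)^`().
    rewrite deriv_map; apply: dvdp_trans hd _.
    by rewrite dvdp_map dvdp_gcdr.
  move/dvdpP: hk => [s sE]; rewrite sE derivM deriv_exp.
  rewrite dvdp_addr; last exact: dvdp_mull.
  rewrite derivXsubC mul1r -[in X in X -> _](prednK kpos) /= exprS.
  rewrite mulrnAr -mulrnAl dvdp_mul2r ?expf_neq0 ?polyXsubC_eq0 //.
  rewrite dvdp_XsubCl rootE hornerMn mulrn_eq0 /= => /eqP sr.
  have : ('X - r%:P) ^+ k.+1 %| map_poly f p.
    by rewrite sE exprS dvdp_mul2r ?expf_neq0 ?polyXsubC_eq0 // dvdp_XsubCl rootE sr.
  by rewrite -mup_geq // ltnn.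
have sz : size rs = (size p).-1.
  have := congr1 (fun q : {poly algC} => size q) rsE.
  by rewrite size_scale ?lead_coef_eq0 // size_prod_XsubC size_map_poly => ->.
have -> : size p = (size rs).+1 by rewrite sz prednK // size_poly_gt0.
rewrite rsE dvdpZl ?lead_coef_eq0 // exprS dvdp_mull //.
have : {in rs, forall r, root (map_poly f u) r}.
  move=> r rin; apply: root_u; rewrite rsE rootZ ?lead_coef_eq0 //.
  by rewrite root_prod_XsubC.
elim: (rs) => [|r rs' IH] h; first by rewrite big_nil expr0.
rewrite big_cons exprS dvdp_mul //; first by rewrite dvdp_XsubCl h ?mem_head.
by apply: IH => x xin; apply: h; rewrite inE xin orbT.
Qed.

(** * The regular representation and its diagonalization *)

Section RegularRepresentation.
Variables (R : comPzRingType) (n' : nat).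
Local Notation n := n'.+1.
Variables (f : R -> 'rV[int]_n).
Hypothesis fbij : bijective f.
Hypothesis fD : forall x y, f (x + y) = f x + f y.

Lemma endo_matrix (T : R -> R) : (forall x y, T (x + y) = T x + T y) ->
  exists M : 'M[int]_n, forall x, f (T x) = f x *m M.
Proof.
move=> TD; have [g fK gK] := fbij.
have gD x y : g (x + y) = g x + g y.
  by apply: (can_inj fK); rewrite fD !gK.
have [|M hM] := @additive_matrix n n (fun v => f (T (g v))).
  by move=> x y; rewrite gD TD fD.
by exists M => x; rewrite -hM fK.
Qed.

Lemma coord_inj_matrix (M N : 'M[int]_n) :
  (forall x, f x *m M = f x *m N) -> M = N.
Proof.
move=> h; have [g fK gK] := fbij; apply/row_matrixP => i.
by rewrite !rowE -(gK (delta_mx 0 i)) h.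
Qed.

Lemma regular_representation : exists M : R -> 'M[int]_n,
  [/\ forall x y, f (x * y) = f x *m M y,
      forall x y, M (x + y) = M x + M y,
      forall x y, M (x * y) = M x * M y,
      M 1 = 1 & injective M].
Proof.
have /choice[M hM] y : exists M : 'M[int]_n, forall x, f (x * y) = f x *m M.
  by apply: endo_matrix => u v; rewrite mulrDl.
exists M; split=> //.
- by move=> x y; apply: coord_inj_matrix => z; rewrite mulmxDr -!hM -fD mulrDr.
- move=> x y; apply: coord_inj_matrix => z.
  by rewrite -!hM mulrA hM hM mulmxA.
- by apply: coord_inj_matrix => z; rewrite -!hM mulr1 mulmx1.
- move=> x y Mxy; apply: (bij_inj fbij).
  by rewrite -[x]mul1r -[y]mul1r !hM Mxy.
Qed.

Hypothesis Rred : reduced R.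
Local Notation toC := (map_mx (intr : int -> algC)).

(** Clearing denominators in the squarefree part [u] of the characteristic polynomial gives an
    integer polynomial [r], which can be evaluated at [x] inside [R]. By Cayley-Hamilton the value
    is nilpotent, hence zero as [R] is reduced; thus the separable [u] kills the matrix. *)
Lemma diagonalizable_regular (M : R -> 'M[int]_n) :
    (forall x y, M (x + y) = M x + M y) ->
    (forall x y, M (x * y) = M x * M y) ->
    M 1 = 1 -> injective M -> forall x, diagonalizable (toC (M x)).
Proof.
move=> MD MM M1 Minj x.
have M0 := additive_map0 MD.
have MX y k : M (y ^+ k) = M y ^+ k.
  by elim: k => [|k IH]; rewrite ?expr0 ?M1 // !exprS MM IH.
have Mint (c : int) : exists y, M y = c%:M.
  by exists c%:~R; rewrite (additive_mapMz MD) M1 -scaler_int intz scalemx1.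
have Mpoly (r : {poly int}) : exists y, M y = horner_mx (M x) r.
  elim/poly_ind: r => [|r c [y yE]]; first by exists 0; rewrite rmorph0.
  have [z zE] := Mint c; exists (y * x + z).
  by rewrite MD MM yE zE rmorphD rmorphM /= horner_mx_X horner_mx_C.
pose A : 'M[rat]_n := map_mx intr (M x).
have p0 : char_poly A != 0 by rewrite monic_neq0 ?char_poly_monic.
have [u [k [pdvd u0 usep]]] := squarefree_part p0.
have [r [a a0 uE]] := rat_poly_scale u.
have hu : horner_mx A u = 0.
  have [y yE] := Mpoly r.
  have hr : horner_mx A (map_poly intr r) = map_mx intr (M y).
    by rewrite -map_horner_mx -yE.
  suff y0 : y = 0 by rewrite uE linearZ /= hr y0 M0 map_mx0 scaler0.
  apply: (Rred (n := k)); apply: Minj; rewrite M0 MX.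
  suff: map_mx (intr : int -> rat) (M y ^+ k) = map_mx intr 0.
    by move=> /matrixP h; apply/matrixP => i j; move: (h i j); rewrite !mxE => /intr_inj.
  rewrite rmorphXn /= -hr map_mx0 -rmorphXn /=.
  have -> : map_poly intr r = a%:~R *: u by rewrite uE scalerA divff ?intr_eq0 // scale1r.
  rewrite exprZn linearZ /=; have [q ->] := dvdpP _ _ pdvd.
  by rewrite rmorphM /= Cayley_Hamilton mulr0 scaler0.
have toCE : toC (M x) = map_mx (ratr : rat -> algC) A.
  by apply/matrixP => i j; rewrite !mxE ratr_int.
apply/mxpoly.diagonalizableP; rewrite toCE.
have [rs rsE] := closed_field_poly_normal (map_poly (ratr : rat -> algC) u).
have lu0 : lead_coef (map_poly (ratr : rat -> algC) u) != 0.
  by rewrite lead_coef_eq0 map_poly_eq0.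
exists rs.
  rewrite -separable_prod_XsubC.
  have : separable_poly (map_poly (ratr : rat -> algC) u) by rewrite separable_map.
  by rewrite rsE (eqp_separable (eqp_scale _ lu0)).
rewrite -(dvdpZr _ _ lu0) -rsE; apply: mxminpoly_min.
by rewrite -map_horner_mx hu map_mx0.
Qed.
End RegularRepresentation.

Definition ringhom (A B : pzRingType) (f : A -> B) : Prop :=
  [/\ forall x y, f (x + y) = f x + f y, forall x y, f (x * y) = f x * f y & f 1 = 1].

(** * Ring homomorphisms to the algebraic numbers *)

Section Embeddings.
Variables (R : comPzRingType) (n' : nat).
Local Notation n := n'.+1.
Variables (f : R -> 'rV[int]_n).
Hypothesis fbij : bijective f.
Hypothesis fD : forall x y, f (x + y) = f x + f y.
Local Notation toC := (map_mx (intr : int -> algC)).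

Lemma coord_expand (phi : R -> algC) (g : 'rV[int]_n -> R) : cancel g f ->
  (forall x y, phi (x + y) = phi x + phi y) ->
  forall x, phi x = \sum_i (f x 0 i)%:~R * phi (g (delta_mx 0 i)).
Proof.
move=> gK phiD x; have fK : cancel f g by move=> y; apply: (bij_inj fbij); rewrite gK.
have gD u v : g (u + v) = g u + g v by apply: (can_inj fK); rewrite fD !gK.
have hD u v : phi (g (u + v)) = phi (g u) + phi (g v) by rewrite gD phiD.
rewrite -{1}[x]fK {1}[f x]row_sum_delta.
rewrite (additive_map_sum hD); apply: eq_bigr => i _.
by rewrite -[in LHS](intz (f x 0 i)) scaler_int (additive_mapMz hD) mulrzl.
Qed.

Hypothesis Rred : reduced R.

(** The matrices of multiplication by the basis elements commute and are diagonalizable, so one [P]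
    diagonalizes all. The diagonal entries are the [lam j], and [L] tabulates them on the basis. *)
Lemma complex_embeddings : exists (lam : 'I_n -> R -> algC) (L : 'M[algC]_n),
  [/\ L \in unitmx, forall j, ringhom (lam j) &
      forall x j, lam j x = (toC (f x) *m L) 0 j].
Proof.
have [M [fM MD MM M1 Minj]] := regular_representation fbij fD.
have Mdiag := diagonalizable_regular Rred MD MM M1 Minj.
have [g fK gK] := fbij; pose e (i : 'I_n) := g (delta_mx 0 i).
have [P Pu] : mxpoly.codiagonalizable [seq toC (M (e i)) | i <- enum 'I_n].
  apply/mxpoly.codiagonalizableP; split.
    move=> _ _ /mapP[i _ ->] /mapP[j _ ->].
    by rewrite /comm_mx -!map_mxM; congr map_mx; rewrite !mulmxE -!MM mulrC.
  by move=> _ /mapP[i _ ->]; apply: Mdiag.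
move=> /allP Pdiag; pose N x := P *m toC (M x) *m invmx P.
have ND x y : N (x + y) = N x + N y.
  by rewrite /N MD map_mxD mulmxDr mulmxDl.
have NM x y : N (x * y) = N x *m N y.
  by rewrite /N MM map_mxM !mulmxA mulmxKV.
have N1 : N 1 = 1%:M by rewrite /N M1 map_mx1 mulmx1 mulmxV.
have Noff x (i j : 'I_n) : i != j -> N x i j = 0.
  move=> ij; rewrite (coord_expand (phi := fun x => N x i j) gK); last first.
    by move=> u v; rewrite ND mxE.
  rewrite big1 // => k _; suff -> : N (g (delta_mx 0 k)) i j = 0 by rewrite mulr0.
  have /Pdiag/= : toC (M (e k)) \in [seq toC (M (e i)) | i <- enum 'I_n].
    by apply/mapP; exists k; rewrite ?mem_enum.
  by move=> /(mxpoly.diagonalizable_forP _ Pu) -> //.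
pose lam j x := N x j j.
have lamE x : N x = diag_mx (\row_j lam j x).
  apply/matrixP => i j; rewrite [RHS]mxE [in RHS]mxE.
  by have [<-|ij] := eqVneq i j; rewrite ?mulr1n // mulr0n Noff.
have lamP j : ringhom (lam j).
  split; first by move=> x y; rewrite /lam ND mxE.
    move=> x y; rewrite {1}/lam NM (lamE x) (lamE y) mulmx_diag [LHS]mxE eqxx mulr1n.
    by rewrite mxE (mxE _ _ 0 j) (mxE _ _ 0 j).
  by rewrite /lam N1 mxE eqxx.
pose L : 'M[algC]_n := \matrix_(i, j) lam j (e i).
have LE x j : lam j x = (toC (f x) *m L) 0 j.
  rewrite (coord_expand (phi := lam j) gK); last by case: (lamP j).
  by rewrite mxE; apply: eq_bigr => i _; rewrite !mxE.
exists lam, L; split=> //.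
(* [w] holds the coordinates of 1 in the eigenbasis. Since [f x] is [f 1] times the matrix of [x],
   expanding in that basis shows that [diag_mx w *m P] inverts [L]. *)
pose w := toC (f 1) *m invmx P.
suff : L *m (diag_mx w *m P) = 1%:M by case/mulmx1_unit.
apply/row_matrixP => i; rewrite rowE rowE mulmx1.
have eE : toC (f (e i)) = delta_mx 0 i.
  by rewrite gK; apply/matrixP => a b; rewrite !mxE; case: andb.
rewrite -eE mulmxA.
have -> : toC (f (e i)) *m L = \row_j lam j (e i).
  by apply/rowP => j; rewrite -LE mxE.
rewrite mulmxA.
have -> : (\row_j lam j (e i)) *m diag_mx w = w *m diag_mx (\row_j lam j (e i)).
  by apply/rowP => j; rewrite !mul_mx_diag !mxE mulrC.
rewrite -lamE /w /N !mulmxA mulmxKV // mulmxKV // -map_mxM -fM mul1r //.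
Qed.

Variables (lam : 'I_n -> R -> algC) (L : 'M[algC]_n).
Hypothesis Lu : L \in unitmx.
Hypothesis lamP : forall j, ringhom (lam j).
Hypothesis LE : forall x j, lam j x = (toC (f x) *m L) 0 j.

(** As [L] is invertible, [phi] is a combination of the [lam j] with coefficients [c].
    Multiplicativity makes the coefficients orthogonal idempotents of a field, so one equals 1 and
    the others vanish. *)
Lemma ringhom_embedding (phi : R -> algC) : ringhom phi ->
  exists j, forall x, phi x = lam j x.
Proof.
case=> phiD phiM phi1; have [g fK gK] := fbij.
pose e (i : 'I_n) := g (delta_mx 0 i).
have eE i : toC (f (e i)) = delta_mx 0 i.
  by rewrite gK; apply/matrixP => a b; rewrite !mxE; case: andb.
pose c : 'cV_n := invmx L *m \col_i phi (e i).
have cE x : phi x = \sum_j lam j x * c j 0.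
  transitivity ((toC (f x) *m L *m c) 0 0).
    rewrite /c mulmxA mulmxK // (coord_expand gK phiD) mxE.
    by apply: eq_bigr => i _; rewrite !mxE.
  by rewrite mxE; apply: eq_bigr => j _; rewrite -LE.
have LeE i j : L i j = lam j (e i) by rewrite LE eE -rowE mxE.
have key : diag_mx c^T = c *m c^T.
  have LTu : L^T \in unitmx by rewrite unitmx_tr.
  apply: (can_inj (mulKmx Lu)); apply: (can_inj (mulmxK LTu)).
  apply/matrixP => i k.
  have -> : (L *m (c *m c^T) *m L^T) i k = phi (e i) * phi (e k).
    rewrite mulmxA -(mulmxA (L *m c)) -trmx_mul mxE big_ord1 !mxE !cE.
    by congr (_ * _); apply: eq_bigr => j _; rewrite LeE.
  rewrite -phiM cE mxE; apply: eq_bigr => j _.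
  rewrite mul_mx_diag !mxE !LeE; have [_ -> _] := lamP j.
  by rewrite mulrAC.
have [j cj] : exists j, c j 0 != 0.
  apply/existsP; rewrite -negb_forall; apply/negP => /forallP c0.
  have : phi 1 = 0 by rewrite cE big1 // => j _; rewrite (eqP (c0 j)) mulr0.
  by rewrite phi1 => /eqP; rewrite oner_eq0.
have keyE i k : c i 0 * c k 0 = c i 0 *+ (i == k).
  by have /matrixP/(_ i k) := key; rewrite !mxE big_ord1 !mxE => <-.
have cj1 : c j 0 = 1.
  by apply: (mulfI cj); rewrite keyE eqxx mulr1.
exists j => x; rewrite cE (bigD1 j) //= cj1 mulr1 big1 ?addr0 // => i ij.
have := keyE j i; rewrite cj1 mul1r eq_sym (negPf ij) => ->.
by rewrite mulr0.
Qed.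

Lemma embedding_inj j k : (forall x, lam j x = lam k x) -> j = k.
Proof.
move=> h; have [g fK gK] := fbij.
have : col j L = col k L.
  apply/colP => i; rewrite !mxE.
  have := h (g (delta_mx 0 i)); rewrite !LE gK.
  have -> : toC (delta_mx 0 i) = delta_mx 0 i.
    by move=> a; apply/matrixP => u v; rewrite !mxE; case: andb.
  by rewrite -!rowE !mxE.
move/(congr1 (mulmx (invmx L))); rewrite !colE !mulmxA mulVmx // !mul1mx.
move/matrixP/(_ j 0); rewrite !mxE !eqxx /= andbT.
by case: eqP => // _ /eqP; rewrite oner_eq0.
Qed.

End Embeddings.

(** * Orthogonal projections of a lattice *)

(** Roots equal to 0 are divided out one by one. Afterwards the constant term is a nonzero integer,
    so the product of the roots is at least 1, and no factor from [0, 1] can be below 1. *)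
Lemma int_poly_roots01 (p : {poly int}) (rs : seq algC) :
    map_poly intr p = \prod_(z <- rs) ('X - z%:P) ->
    {in rs, forall z, 0 <= z <= 1} -> {in rs, forall z, z = 0 \/ z = 1}.
Proof.
have [k] := ubnP (size rs); elim: k => // k IH in p rs *; rewrite ltnS => rsk pE h.
have [rs0|rs0] := boolP (0 \in rs).
  have pr : perm_eq rs (0 :: rem 0 rs) by exact: perm_to_rem.
  rewrite (perm_big _ pr) big_cons /= in pE.
  have : root p 0.
    by rewrite rootE -(intr_eq0 algC) -horner_map /= pE hornerM !hornerE oppr0 mul0r.
  move/factor_theorem => [q qE].
  have qE' : map_poly intr q = \prod_(j <- rem 0 rs) ('X - j%:P) :> {poly algC}.
    apply: (mulfI (negbT (polyXsubC_eq0 (0 : algC)))).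
    by rewrite -pE qE rmorphM /= map_polyXsubC mulrC.
  move=> z; rewrite (perm_mem pr) inE => /predU1P[->|zin]; first by left.
  apply: (IH _ _ _ qE' _ z zin).
    by rewrite (perm_size pr) /= in rsk.
  by move=> y yin; apply: h; apply: mem_rem yin.
have prod0 : \prod_(z <- rs) z != 0.
  rewrite prodf_seq_neq0; apply/allP => z zin /=.
  by apply: contraNneq rs0 => <-.
have prod1 : 1 <= \prod_(z <- rs) z.
  have e : `|p.[0]|%:~R = \prod_(z <- rs) z :> algC.
    rewrite intr_norm -horner_map /= pE horner_prod normr_prod.
    rewrite !big_seq; apply: eq_bigr => z /h/andP[z0 _].
    by rewrite !hornerE normrN ger0_norm.
  have : p.[0] != 0 by rewrite -normr_eq0 -(intr_eq0 algC) e.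
  by rewrite -e -[1]/(1%:~R) ler_int -normr_gt0 -gtz0_ge1.
move=> z zin; right; apply/eqP; rewrite eq_le.
have /andP[_ ->] /= := h z zin.
rewrite (perm_big _ (perm_to_rem zin)) big_cons /= in prod1.
apply: le_trans prod1 _; rewrite ler_piMr //; first by case/andP: (h z zin).
rewrite big_seq; apply: prodr_ile1 => y yin; apply: h; exact: mem_rem yin.
Qed.

(** * Hermitian matrices and projections *)

Section Hermitian.
Variable n' : nat.
Local Notation n := n'.+1.
Definition adj m p (M : 'M[algC]_(m, p)) : 'M_(p, m) := map_mx Num.conj M^T.

Lemma adjM m p q (A : 'M_(m, p)) (B : 'M_(p, q)) : adj (A *m B) = adj B *m adj A.
Proof. by rewrite /adj trmx_mul map_mxM. Qed.
Lemma adjB m p (A B : 'M_(m, p)) : adj (A - B) = adj A - adj B.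
Proof. by rewrite /adj linearB /= map_mxB. Qed.
Lemma adjK m p (A : 'M_(m, p)) : adj (adj A) = A.
Proof. by apply/matrixP => i j; rewrite !mxE conjCK. Qed.

Definition nrm (v : 'rV[algC]_n) : algC := (v *m adj v) 0 0.

Lemma nrmE v : nrm v = \sum_j `|v 0 j| ^+ 2.
Proof. by rewrite /nrm mxE; apply: eq_bigr => j _; rewrite !mxE normCK. Qed.
Lemma nrm_ge0 v : 0 <= nrm v.
Proof. by rewrite nrmE sumr_ge0 // => j _; rewrite exprn_ge0. Qed.
Lemma nrm_eq0 v : nrm v = 0 -> v = 0.
Proof.
rewrite nrmE => /eqP; rewrite psumr_eq0; last by move=> j _; rewrite exprn_ge0.
move=> /allP h; apply/rowP => j; rewrite mxE.
by have := h j (mem_index_enum j); rewrite /= expf_eq0 /= normr_eq0 => /eqP.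
Qed.

Lemma adj_mul0 (A : 'M[algC]_n) : A *m adj A = 0 -> A = 0.
Proof.
move=> h; apply/row_matrixP => i; rewrite row0; apply: nrm_eq0.
by rewrite /nrm rowE adjM mulmxA -(mulmxA _ A) h mulmx0 mul0mx mxE.
Qed.

(** For Hermitian [A] the power [A ^+ (2 ^ j.+1)] is [A ^+ (2 ^ j)] times its own adjoint, so
    vanishing descends from [j.+1] to [j]. *)
Lemma hermitian_nilpotent (A : 'M[algC]_n) k : adj A = A -> A ^+ k = 0 -> A = 0.
Proof.
move=> hA Ak; have hX j : adj (A ^+ j) = A ^+ j.
  elim: j => [|j IH]; first by rewrite expr0 /adj trmx1 map_mx1.
  by rewrite [in LHS]exprS -mulmxE adjM IH hA mulmxE -exprSr.
suff h j : A ^+ (2 ^ j) = 0 -> A = 0.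
  by apply: (h k); rewrite -(subnK (ltnW (ltn_expl k (ltnSn 1)))) exprD Ak mulr0.
elim: j => [|j IH]; first by rewrite expr1.
rewrite expnS mul2n -addnn exprD => Aj; apply: IH; apply: adj_mul0.
by rewrite hX mulmxE.
Qed.

(** Pythagoras for the complementary projections [Q] and [1%:M - Q]. *)
Lemma nrm_projection (Q : 'M[algC]_n) v : adj Q = Q -> Q *m Q = Q -> nrm (v *m Q) <= nrm v.
Proof.
move=> hQ QQ; suff -> : nrm v = nrm (v *m Q) + nrm (v *m (1%:M - Q)).
  by rewrite lerDl nrm_ge0.
have h1 : adj (1%:M - Q) = 1%:M - Q by rewrite adjB hQ /adj trmx1 map_mx1.
have h2 : (1%:M - Q) *m (1%:M - Q) = 1%:M - Q.
  by rewrite mulmxBr mulmx1 mulmxBl mul1mx QQ subrr subr0.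
have E (A : 'M[algC]_n) : adj A = A -> A *m A = A -> nrm (v *m A) = (v *m A *m adj v) 0 0.
  by move=> hA AA; rewrite /nrm adjM hA mulmxA -(mulmxA v A A) AA.
rewrite (E Q hQ QQ) (E _ h1 h2) mulmxBr mulmx1 mulmxBl /nrm.
by move: (v *m adj v) (v *m Q *m adj v) => a b; rewrite !mxE addrCA subrr addr0.
Qed.

(* The eigenvalues of [P Q P] are algebraic integers, all of whose conjugates
   lie in [0, 1]; hence they are 0 or 1 and [P Q P] is idempotent. *)
Lemma integral_projections_commute (P Q : 'M[algC]_n) (p : {poly int}) :
    adj P = P -> adj Q = Q -> P *m P = P -> Q *m Q = Q ->
    char_poly (P *m Q *m P) = map_poly intr p ->
  P *m Q = Q *m P.
Proof.
move=> hP hQ PP QQ pE; set S := P *m Q *m P.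
have hS : adj S = S by rewrite /S !adjM hP hQ mulmxA.
have SE : S = (P *m Q) *m adj (P *m Q).
  by rewrite adjM hP hQ mulmxA -(mulmxA P Q Q) QQ.
have [rs rsE] := closed_field_poly_normal (char_poly S).
rewrite (monicP (char_poly_monic S)) scale1r in rsE.
have rs01 : {in rs, forall z, z = 0 \/ z = 1}.
  apply: (int_poly_roots01 (p := p)); first by rewrite -pE.
  move=> a ain; have : root (char_poly S) a by rewrite rsE root_prod_XsubC.
  rewrite -eigenvalue_root_char => /eigenvalueP[v vS v0].
  have nv : 0 < nrm v.
    rewrite lt_neqAle nrm_ge0 andbT eq_sym; apply: contra v0 => /eqP/nrm_eq0 ->.
    exact: eqxx.
  (* [S] is [P *m Q] times its adjoint, so the eigenvalue [a] is a ratio of squared norms, and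
     projections do not increase these. *)
  have e : a * nrm v = nrm (v *m P *m Q).
    have E U : nrm (v *m U) = (v *m (U *m adj U) *m adj v) 0 0 by rewrite /nrm adjM !mulmxA.
    by rewrite -[v *m P *m Q]mulmxA E -SE vS -scalemxAl mxE.
  rewrite -(pmulr_lge0 _ nv) e nrm_ge0 /= -(ler_pM2r nv) e mul1r.
  exact: le_trans (nrm_projection _ hQ QQ) (nrm_projection _ hP PP).
(* All roots of the characteristic polynomial are 0 or 1, so [S *m S - S] is nilpotent; being
   Hermitian, it is zero. *)
have SS : S *m S = S.
  apply/eqP; rewrite -subr_eq0; apply/eqP.
  apply: (@hermitian_nilpotent _ (size rs)).
    by rewrite adjB adjM hS.
  have -> : S *m S - S = horner_mx S ('X * ('X - 1)).
    by rewrite rmorphM rmorphB /= horner_mx_X rmorph1 mulrBr mulr1.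
  rewrite -rmorphXn /=.
  have /dvdpP[q ->] : char_poly S %| ('X * ('X - 1)) ^+ size rs.
    rewrite rsE; elim: (rs) rs01 => [|z rs' IH] h; first by rewrite big_nil expr0.
    rewrite big_cons exprS dvdp_mul //; last first.
      by apply: IH => y yin; apply: h; rewrite inE yin orbT.
    rewrite dvdp_XsubCl rootE !hornerE.
    by case: (h z (mem_head _ _)) => ->; rewrite ?mul0r // subrr mulr0.
  by rewrite rmorphM /= Cayley_Hamilton mulr0.
(* The adjoint of [Q *m P - S] times [Q *m P - S] expands to [S - S - S + S]. So [Q *m P] is the
   Hermitian matrix [S]. *)
have QP : Q *m P = S.
  apply/eqP; rewrite -subr_eq0; apply/eqP.
  rewrite -[LHS]adjK; suff -> : adj (Q *m P - S) = 0 by rewrite /adj trmx0 map_mx0.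
  apply: adj_mul0; rewrite adjK adjB hS adjM hP hQ mulmxBl !mulmxBr.
  have -> : P *m Q *m (Q *m P) = S by rewrite mulmxA -(mulmxA P Q Q) QQ.
  have -> : P *m Q *m S = S.
    by rewrite -[RHS]SS /S !mulmxA -(mulmxA _ P P) PP.
  have -> : S *m (Q *m P) = S.
    by rewrite -[RHS]SS /S !mulmxA -(mulmxA _ P P) PP.
  by rewrite SS subrr.
by rewrite QP -hS -QP adjM hP hQ.
Qed.
End Hermitian.

(** * Gradings *)

(* [P g] is the projection onto the component of degree [g]. *)
Record grading (R : comPzRingType) (gT : finGroupType) (P : gT -> R -> R) : Prop := Grading {
  grD : forall g x y, P g (x + y) = P g x + P g y;
  grP : forall g h x, P g (P h x) = if g == h then P h x else 0;
  gr_sum : forall x, \sum_g P g x = x;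
  grM : forall g h x y, P (g * h)%g (P g x * P h y) = P g x * P h y;
  gr1 : P 1%g 1 = 1 }.

Section Grading.
Variables (R : comPzRingType) (gT : finGroupType) (P : gT -> R -> R).
Hypothesis gP : grading P.

Lemma gr0 g : P g 0 = 0.
Proof. exact: (additive_map0 (grD gP g)). Qed.

Lemma grS (I : Type) (r : seq I) (Q : pred I) (F : I -> R) g :
  P g (\sum_(i <- r | Q i) F i) = \sum_(i <- r | Q i) P g (F i).
Proof. exact: (additive_map_sum (grD gP g)). Qed.

Lemma gr_homE g h x : P g x = x -> P h x = if h == g then x else 0.
Proof. by move=> <-; rewrite (grP gP). Qed.

Lemma gr_homM g h x y : P g x = x -> P h y = y -> P (g * h)%g (x * y) = x * y.
Proof. by move=> <- <-; rewrite (grM gP). Qed.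

Lemma gr_ext (F G : R -> R) :
    (forall x y, F (x + y) = F x + F y) -> (forall x y, G (x + y) = G x + G y) ->
    (forall g x, P g x = x -> F x = G x) -> forall x, F x = G x.
Proof.
move=> FD GD h x; rewrite -(gr_sum gP x).
rewrite (additive_map_sum FD) (additive_map_sum GD); apply: eq_bigr => g _.
by apply: (h g); rewrite (grP gP) eqxx.
Qed.

Lemma gr_homB g x y : P g x = x -> P g y = y -> P g (x - y) = x - y.
Proof. by move=> hx hy; rewrite (additive_mapB (grD gP g)) hx hy. Qed.

Lemma gr_mulr g h x y : P h y = y -> P (g * h)%g (x * y) = P g x * y.
Proof.
move=> hy; apply: (@gr_ext (fun x => P (g * h)%g (x * y)) (fun x => P g x * y)).
- by move=> a b; rewrite mulrDl (grD gP).
- by move=> a b; rewrite (grD gP) mulrDl.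
move=> k a ha; rewrite (gr_homE _ (gr_homM ha hy)) (gr_homE _ ha).
by rewrite (inj_eq (mulIg h)); case: eqP; rewrite ?mul0r.
Qed.
End Grading.

Lemma char_poly_conj n (V A : 'M[algC]_n) : V \in unitmx ->
  char_poly (invmx V *m A *m V) = char_poly A.
Proof.
move=> Vu; rewrite /char_poly /char_poly_mx !map_mxM.
set X := 'X%:M; set W := map_mx polyC (invmx V); set V' := map_mx polyC V.
have WV : W *m V' = 1%:M by rewrite -map_mxM mulVmx // map_mx1.
have -> : X - W *m map_mx polyC A *m V' = W *m (X - map_mx polyC A) *m V'.
  rewrite mulmxBr mulmxBl; congr (_ - _).
  by rewrite /X scalar_mxC -mulmxA WV mulmx1.
by rewrite !det_mulmx mulrAC -det_mulmx WV det1 mul1r.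
Qed.

(** * The Hermitian form given by the embeddings *)

Section Form.
Variables (R : comPzRingType) (n' : nat).
Local Notation n := n'.+1.
Variables (f : R -> 'rV[int]_n).
Hypothesis fbij : bijective f.
Hypothesis fD : forall x y, f (x + y) = f x + f y.
Local Notation toC := (map_mx (intr : int -> algC)).
Variables (lam : 'I_n -> R -> algC) (L : 'M[algC]_n).
Hypothesis Lu : L \in unitmx.
Hypothesis lamP : forall j, ringhom (lam j).
Hypothesis LE : forall x j, lam j x = (toC (f x) *m L) 0 j.

Definition hform x y : algC := \sum_j lam j x * (lam j y)^*.

(** Rescaling components by a linear character [c] with [c (g * h^-1) != 1] respects products, so it
    permutes the embeddings [lam j]. The form is unchanged by this, yet multiplied by
    [c (g * h^-1)]; hence it vanishes. *)
Lemma hform_homogeneous (gT : finGroupType) (P : gT -> R -> R) g h x y :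
  commutative (@mulg gT) -> grading P -> g != h -> P g x = x -> P h y = y -> hform x y = 0.
Proof.
move=> cG gP gh hx hy.
have abG : abelian [set: gT] by apply/centsP => a _ b _; apply: cG.
have [i chi_gh] : exists i : Iirr [set: gT], 'chi_i (g * h^-1)%g != 1.
  apply/existsP; rewrite -negb_forall; apply/negP => /forallP H.
  have : (g * h^-1)%g \in \bigcap_i cfker 'chi[[set: gT]%G]_i.
    apply/bigcapP => i _; rewrite cfkerEirr inE lin_char1; last exact/char_abelianP.
    by move: (H i).
  by rewrite TI_cfker_irr inE -eq_mulgV1 (negPf gh).
have lc : 'chi_i \is a linear_char by apply/char_abelianP.
pose c := 'chi_i; have cM a b : c (a * b)%g = c a * c b by rewrite lin_charM ?inE.
have c0 a : c a != 0 by rewrite lin_char_neq0 ?inE.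
have lamD j := let: And3 h _ _ := lamP j in h.
have lamM j := let: And3 _ h _ := lamP j in h.
have lam1 j := let: And3 _ _ h := lamP j in h.
have lam0 j := additive_map0 (lamD j).
pose phi j z := \sum_k c k * lam j (P k z).
have phi_hom j a z : P a z = z -> phi j z = c a * lam j z.
  move=> hz; rewrite /phi (bigD1 a) //= hz big1 ?addr0 // => k ka.
  by rewrite (gr_homE gP k hz) (negPf ka) lam0 mulr0.
have phiD j u v : phi j (u + v) = phi j u + phi j v.
  rewrite /phi -big_split; apply: eq_bigr => k _ /=.
  by rewrite (grD gP) lamD mulrDr.
have phiP j : ringhom (phi j).
  split=> //.
    move=> u v; rewrite -(gr_sum gP u) -(gr_sum gP v) mulr_suml.
    rewrite !(additive_map_sum (phiD j)) mulr_suml; apply: eq_bigr => a _.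
    rewrite mulr_sumr mulr_sumr (additive_map_sum (phiD j)).
    apply: eq_bigr => b _.
    have ha : P a (P a u) = P a u by rewrite (grP gP) eqxx.
    have hb : P b (P b v) = P b v by rewrite (grP gP) eqxx.
    rewrite (phi_hom _ _ _ (gr_homM gP ha hb)) (phi_hom _ _ _ ha) (phi_hom _ _ _ hb).
    by rewrite cM lamM mulrACA.
  by rewrite (phi_hom _ _ _ (gr1 gP)) lam1 mulr1 /c lin_char1.
have /choice[pi piE] j := ringhom_embedding fbij fD Lu lamP LE (phiP j).
have pi_inj : injective pi.
  move=> j k jk; apply: (embedding_inj fbij Lu LE) => z.
  rewrite -(gr_sum gP z) !(additive_map_sum (lamD _)); apply: eq_bigr => a _.
  apply: (mulfI (c0 a)).
  by rewrite -!phi_hom ?(grP gP) ?eqxx // !piE jk.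
have key : hform x y = c (g * h^-1)%g * hform x y.
  rewrite {1}/hform (reindex_inj pi_inj) /= /hform mulr_sumr; apply: eq_bigr => j _.
  rewrite -!piE (phi_hom _ _ _ hx) (phi_hom _ _ _ hy) rmorphM /= mulrACA.
  by rewrite -lin_charV_conj ?inE // -cM.
apply/eqP; move/eqP: key; rewrite -subr_eq0 -{1}[hform x y]mul1r -mulrBl mulf_eq0.
by rewrite subr_eq0 eq_sym (negPf chi_gh).
Qed.

Lemma hformDl x y z : hform (x + y) z = hform x z + hform y z.
Proof.
rewrite /hform -big_split; apply: eq_bigr => j _ /=.
by have [-> _ _] := lamP j; rewrite mulrDl.
Qed.

Lemma hformDr x y z : hform z (x + y) = hform z x + hform z y.
Proof.
rewrite /hform -big_split; apply: eq_bigr => j _ /=.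
by have [-> _ _] := lamP j; rewrite rmorphD mulrDr.
Qed.

Lemma hform_grading (gT : finGroupType) (P : gT -> R -> R) g x y :
  commutative (@mulg gT) -> grading P -> hform (P g x) y = hform x (P g y).
Proof.
move=> cG gP; have ho h z : P h (P h z) = P h z by rewrite (grP gP) eqxx.
transitivity (hform (P g x) (P g y)).
  rewrite -{1}(gr_sum gP y) (additive_map_sum (fun u v => hformDr u v _)).
  rewrite (bigD1 g) //= big1 ?addr0 // => h hg.
  by apply: hform_homogeneous cG gP _ (ho _ _) (ho _ _); rewrite eq_sym.
rewrite -{2}(gr_sum gP x) (additive_map_sum (f := hform^~ _) (fun u v => hformDl u v _)).
rewrite (bigD1 g) //= big1 ?addr0 // => h hg.
exact: hform_homogeneous cG gP hg (ho _ _) (ho _ _).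
Qed.

(** Each [lam j w] has modulus 1, so its inverse [lam j w'] is its conjugate. *)
Lemma hform_root_of_unity w w' k x y :
  w * w' = 1 -> w ^+ k.+1 = 1 -> hform (w * x) y = hform x (w' * y).
Proof.
move=> ww wk; apply: eq_bigr => j _; have [_ lamM lam1] := lamP j.
have lX i : lam j (w ^+ i) = lam j w ^+ i.
  by elim: i => [|i IH]; rewrite ?expr0 // !exprS lamM IH.
have nw : `|lam j w| = 1.
  apply/eqP; rewrite -(@pexpr_eq1 _ _ k.+1) // -normrX -lX wk lam1 normr1 //.
have lw : lam j w * lam j w' = 1 by rewrite -lamM ww.
rewrite !lamM rmorphM /= [lam j w * _]mulrC -mulrA; congr (_ * _).
suff -> : (lam j w')^* = lam j w by [].
have w0 : lam j w != 0 by rewrite -normr_eq0 nw oner_eq0.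
rewrite -[lam j w']mul1r -(mulVf w0) -mulrA lw mulr1 fmorphV /=.
apply: (mulfI (_ : (lam j w)^* != 0)); first by rewrite conjC_eq0.
by rewrite mulfV ?conjC_eq0 // mulrC -normCK nw expr1n.
Qed.

(** Each [lam j e] is 0 or 1, hence real. *)
Lemma hform_idempotent e x y : e * e = e -> hform (e * x) y = hform x (e * y).
Proof.
move=> ee; apply: eq_bigr => j _; have [_ lamM lam1] := lamP j.
rewrite !lamM rmorphM /= [lam j e * _]mulrC -mulrA; congr (_ * (_ * _)).
have /eqP : lam j e * lam j e = lam j e by rewrite -lamM ee.
rewrite -subr_eq0 -{3}[lam j e]mulr1 -mulrBr mulf_eq0 subr_eq0.
by case/orP => /eqP ->; rewrite ?rmorph0 ?rmorph1.
Qed.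

Definition symmetric_projection (T : R -> R) :=
  [/\ forall x y, T (x + y) = T x + T y, forall x, T (T x) = T x &
      forall x y, hform (T x) y = hform x (T y)].

(** In the coordinates [toC (f x) *m L] the form is the standard one, so both maps become Hermitian
    projection matrices [A] and [B]. Conjugation by [L] turns [A *m B *m A] into an integer matrix,
    so its characteristic polynomial is integral. *)
Lemma symmetric_projections_commute T S :
  symmetric_projection T -> symmetric_projection S -> forall x, T (S x) = S (T x).
Proof.
move=> symT symS.
have E (C D : 'M[int]_n) :
    invmx L *m toC C *m L *m (invmx L *m toC D *m L) = invmx L *m toC (C *m D) *m L.
  by rewrite map_mxM !mulmxA mulmxK.
have matP U : symmetric_projection U -> exists (M : 'M[int]_n) (A : 'M[algC]_n),
   [/\ forall x, f (U x) = f x *m M, A = invmx L *m toC M *m L, A *m A = A & adj A = A].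
  case=> UD UU Usym; have [M hM] := endo_matrix fbij fD UD.
  have [A AE] : {A | A = invmx L *m toC M *m L} by eexists.
  exists M, A; split=> //.
    have MM : M *m M = M.
      by apply: (coord_inj_matrix fbij) => x; rewrite mulmxA -!hM UU.
    by rewrite AE E MM.
  have LA : L *m A = toC M *m L by rewrite AE !mulmxA mulmxV // mul1mx.
  have [g fK gK] := fbij; pose e (i : 'I_n) := g (delta_mx 0 i).
  have eE i : toC (f (e i)) = delta_mx 0 i.
    by rewrite gK; apply/matrixP => a b; rewrite !mxE; case: andb.
  have hE x y : hform x y = (toC (f x) *m L *m adj (toC (f y) *m L)) 0 0.
    by rewrite mxE; apply: eq_bigr => j _; rewrite !LE [adj _ _ _]mxE [_^T _ _]mxE.
  have H : L *m A *m adj L = L *m adj A *m adj L.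
    apply/matrixP => i k; have := Usym (e i) (e k).
    rewrite !hE !hM !map_mxM !eE -!(mulmxA _ (toC M) L) -LA !adjM !mulmxA.
    have adjd : adj (delta_mx 0 k : 'rV[algC]_n) = delta_mx k 0.
      by apply/matrixP => a b; rewrite !mxE andbC rmorph_nat.
    by rewrite adjd -!(mulmxA (delta_mx 0 i)) -!rowE -!colE !mxE.
  have aLu : adj L \in unitmx by rewrite /adj map_unitmx unitmx_tr.
  move/(can_inj (mulmxK aLu)): H => /(can_inj (mulKmx Lu)) //.
have [M [A [hM AE AA aA]]] := matP T symT.
have [N [B [hN BE BB aB]]] := matP S symS.
have AB : A *m B = B *m A.
  apply: (@integral_projections_commute _ _ _ (char_poly (M *m N *m M))) => //.
  have -> : A *m B *m A = invmx L *m toC (M *m N *m M) *m L.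
    by rewrite AE BE !E.
  by rewrite char_poly_conj // map_char_poly.
move=> x; apply: (bij_inj fbij); rewrite !hM !hN hM -!mulmxA; congr (f x *m _).
have : toC (N *m M) = toC (M *m N).
  have Lu' : invmx L \in unitmx by rewrite unitmx_inv.
  move: AB; rewrite AE BE !E => /(can_inj (mulmxK Lu)) /(can_inj (mulKmx Lu')) -> //.
by move/matrixP => h; apply/matrixP => i j; move: (h i j); rewrite !mxE => /intr_inj.
Qed.
End Form.

(** * Commutation of gradings, idempotents and roots of unity *)

Section ReducedOrder.
Variable R : comPzRingType.
Hypothesis (Rord : is_order R) (Rred : reduced R) (R1 : (1 : R) != 0).

Lemma reduced_order_form : exists (n' : nat) (f : R -> 'rV[int]_n'.+1)
    (lam : 'I_n'.+1 -> R -> algC) (L : 'M[algC]_n'.+1),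
  [/\ bijective f, forall x y, f (x + y) = f x + f y, L \in unitmx,
      forall j, ringhom (lam j) &
      forall x j, lam j x = (map_mx intr (f x) *m L) 0 j].
Proof.
have [n [f [fbij fD]]] := Rord; case: n => [|n'] in f fbij fD *.
  case/eqP: R1; apply: (bij_inj fbij); apply/rowP; case=> //.
have [lam [L [Lu lamP LE]]] := complex_embeddings fbij fD Rred.
by exists n', f, lam, L.
Qed.

Lemma gradings_commute (gT hT : finGroupType) (P : gT -> R -> R) (Q : hT -> R -> R) :
    commutative (@mulg gT) -> commutative (@mulg hT) -> grading P -> grading Q ->
  forall g h x, P g (Q h x) = Q h (P g x).
Proof.
move=> cG cH gP gQ g h.
have [n' [f [lam [L [fbij fD Lu lamP LE]]]]] := reduced_order_form.
apply: (symmetric_projections_commute fbij fD Lu LE).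
  split; [exact: grD | by move=> x; rewrite (grP gP) eqxx |].
  move=> x y; exact: (hform_grading fbij fD Lu lamP LE).
split; [exact: grD | by move=> x; rewrite (grP gQ) eqxx |].
move=> x y; exact: (hform_grading fbij fD Lu lamP LE).
Qed.

(** Multiplication by an idempotent is a symmetric projection too. For [x = 1] the conclusion says
    that idempotents have degree 1. *)
Lemma grading_idempotent (gT : finGroupType) (P : gT -> R -> R) (e : R) :
    commutative (@mulg gT) -> grading P -> e * e = e ->
  forall g x, P g (e * x) = e * P g x.
Proof.
move=> cG gP ee g.
have [n' [f [lam [L [fbij fD Lu lamP LE]]]]] := reduced_order_form.
apply: (@symmetric_projections_commute _ _ _ fbij fD _ _ Lu LE (P g) (fun x => e * x)).
  split; [exact: grD | by move=> x; rewrite (grP gP) eqxx |].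
  move=> x y; exact: (hform_grading fbij fD Lu lamP LE).
split; [exact: mulrDr | by move=> x; rewrite mulrA ee |].
by move=> x y; apply: hform_idempotent.
Qed.

(* Multiplication by [w] is an isometry, so it carries the orthogonal
   decomposition given by [P] to another one, which commutes with [P]. *)
Lemma grading_root_of_unity (gT : finGroupType) (P : gT -> R -> R) (w w' : R) k :
    commutative (@mulg gT) -> grading P -> w * w' = 1 -> w ^+ k.+1 = 1 ->
  forall g h, (P g w * w') * (P h w * w') = if g == h then P g w * w' else 0.
Proof.
move=> cG gP ww wk.
have [n' [f [lam [L [fbij fD Lu lamP LE]]]]] := reduced_order_form.
have w'w : w' * w = 1 by rewrite mulrC.
have w'k : w' ^+ k.+1 = 1 by rewrite -[LHS]mul1r -wk -exprMn ww expr1n.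
have comm h x : P 1%g (w' * P h (w * x)) = w' * P h (w * P 1%g x).
  apply: (@symmetric_projections_commute _ _ _ fbij fD _ _ Lu LE (P 1%g)
    (fun x => w' * P h (w * x))).
    split; [exact: grD | by move=> y; rewrite (grP gP) eqxx |].
    move=> y z; exact: (hform_grading fbij fD Lu lamP LE).
  split=> [y z|y|y z]; first by rewrite mulrDr (grD gP) mulrDr.
    by rewrite [w * (w' * _)]mulrA ww mul1r (grP gP) eqxx.
  rewrite (hform_root_of_unity lamP _ _ w'w w'k) (hform_grading fbij fD Lu lamP LE _ _ _ cG gP).
  by rewrite (hform_root_of_unity lamP _ _ ww wk).
have deg1 h : P 1%g (P h w * w') = P h w * w'.
  have := comm h 1; rewrite (gr1 gP) mulr1 => e.
  by rewrite mulrC -{2}e.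
move=> g h.
have Pg : P g w * w' * w = P g w by rewrite -mulrA w'w mulr1.
(* A factor of degree 1 passes through [P h], so idempotence and orthogonality are read off from the
   components of [w]. *)
have e1 : P h (P g w * w' * w) = P g w * w' * P h w.
  by rewrite [_ * w]mulrC -{1}[h]mulg1 (gr_mulr gP h w (deg1 g)) mulrC.
rewrite Pg (grP gP) in e1.
rewrite [P h w * w']mulrC mulrA mulrAC -e1 eq_sym; case: eqP => _; rewrite ?mul0r //.
Qed.
End ReducedOrder.

(** * Two group ring structures on one ring *)

Definition ghom (C H : finGroupType) (a : C -> H) : Prop := forall x y, a (x * y)%g = (a x * a y)%g.
Definition uhom (R : pzRingType) (C : finGroupType) (u : C -> R) : Prop :=
  (forall x y, u (x * y)%g = u x * u y) /\ u 1%g = 1.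

Lemma ghom1 (C H : finGroupType) (a : C -> H) : ghom a -> a 1%g = 1%g.
Proof. by move=> ha; apply: (mulgI (a 1%g)); rewrite -ha !mulg1. Qed.
Lemma ghomV (C H : finGroupType) (a : C -> H) x : ghom a -> a (x^-1)%g = (a x)^-1%g.
Proof. by move=> ha; apply: (mulgI (a x)); rewrite -ha !mulgV ghom1. Qed.

(* A finite abelian group is indecomposable iff its endomorphism ring is local. *)
Definition local_group (C : finGroupType) : Prop :=
  forall a : C -> C, ghom a -> injective a \/ injective (fun x => x * (a x)^-1)%g.

Lemma mulg_divACA (C : finGroupType) (x y z t : C) : commutative (@mulg C) ->
  (x * y * (z * t)^-1 = (x * z^-1) * (y * t^-1))%g.
Proof. by move=> cC; rewrite invMg [(t^-1 * _)%g]cC !mulgA -(mulgA x) [(y * _)%g]cC mulgA. Qed.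

Lemma uhomV (R : comPzRingType) (C : finGroupType) (u : C -> R) c : uhom u -> u c * u c^-1%g = 1.
Proof. by case=> uM u1; rewrite -uM mulgV. Qed.

(** * Gluing along orthogonal idempotents *)

Section OrthogonalIdempotents.
Variables (R : comPzRingType) (I : finType) (E : I -> R).
Hypothesis E1 : \sum_i E i = 1.
Hypothesis EE : forall i j, E i * E j = if i == j then E i else 0.

Definition glue (x : I -> R) := \sum_i E i * x i.

Lemma glueE j x : E j * glue x = E j * x j.
Proof.
rewrite /glue mulr_sumr (bigD1 j) //= mulrA EE eqxx big1 ?addr0 // => i ij.
by rewrite mulrA EE eq_sym (negPf ij) mul0r.
Qed.

(** Testing on nonzero pieces only matters because the degree maps are known to be homomorphisms
    only there. *)
Lemma E_ext x y : (forall i, E i != 0 -> E i * x = E i * y) -> x = y.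
Proof.
move=> h; rewrite -[x]mul1r -[y]mul1r -E1 !mulr_suml; apply: eq_bigr => i _.
by have [->|/h//] := eqVneq (E i) 0; rewrite !mul0r.
Qed.
End OrthogonalIdempotents.

Lemma inj_endo_bij (C H : finGroupType) (a : C -> H) : #|C| = #|H| -> ghom a -> injective a ->
  exists b : H -> C, [/\ ghom b, cancel a b & cancel b a].
Proof.
move=> CH ha ia; have [b ab ba] : bijective a by apply: inj_card_bij; rewrite ?CH.
by exists b; split=> // x y; apply: ia; rewrite ha !ba.
Qed.

(** * A partition making both families of units homogeneous *)

Section TwoGradings.
Variable R : comPzRingType.
Hypothesis (Rord : is_order R) (Rred : reduced R) (R1 : (1 : R) != 0).
Variables (C H : finGroupType).
Hypotheses (cC : commutative (@mulg C)) (cH : commutative (@mulg H)).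
Variables (P : C -> R -> R) (u : C -> R) (Q : H -> R -> R) (v : H -> R).
Hypotheses (gP : grading P) (gQ : grading Q) (uM : uhom u) (vM : uhom v).
Hypotheses (Pu : forall c, P c (u c) = u c) (Qv : forall h, Q h (v h) = v h).

Lemma uhomX (G : finGroupType) (w : G -> R) g k : uhom w -> w g ^+ k = w (g ^+ k)%g.
Proof.
by case=> wM w1; elim: k => [|k IH]; rewrite ?expr0 ?expg0 ?w1 // exprS expgS wM IH.
Qed.

Lemma root_idempotents (G K : finGroupType) (S : G -> R -> R) (w : K -> R) (k : K) :
    commutative (@mulg G) -> grading S -> uhom w ->
  (forall g h, (S g (w k) * w k^-1%g) * (S h (w k) * w k^-1%g) =
     if g == h then S g (w k) * w k^-1%g else 0) /\ \sum_g S g (w k) * w k^-1%g = 1.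
Proof.
move=> cG gS hw; split.
  apply: (@grading_root_of_unity _ Rord Rred R1 _ _ _ _ #[k]%g.-1) => //.
    exact: uhomV.
  by rewrite uhomX // prednK // expg_order; case: hw.
by rewrite -mulr_suml (gr_sum gS) uhomV.
Qed.

(* [Q h (u c) / u c] is idempotent, and for each [c] these sum to 1 over [h];
   expand the product over [c] of these sums, and of those with [P] and [v]. *)
Lemma homogeneous_partition : exists (I : finType) (E : I -> R) (a : I -> C -> H) (b : I -> H -> C),
  [/\ \sum_i E i = 1, forall i j, E i * E j = if i == j then E i else 0,
      forall i c, Q (a i c) (E i * u c) = E i * u c &
      forall i h, P (b i h) (E i * v h) = E i * v h].
Proof.
pose eps c h := Q h (u c) * u c^-1%g; pose eta h c := P c (v h) * v h^-1%g.
have epsP c : (forall h k, eps c h * eps c k = if h == k then eps c h else 0) /\ \sum_h eps c h = 1.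
  exact: root_idempotents c cH gQ uM.
have etaP h : (forall c k, eta h c * eta h k = if c == k then eta h c else 0) /\ \sum_c eta h c = 1.
  exact: root_idempotents h cC gP vM.
(* An index chooses a degree in [H] for every [u c] and a degree in [C] for every [v h]; the product
   may vanish for many choices. *)
pose E (i : {ffun C -> H} * {ffun H -> C}) :=
  (\prod_c eps c (i.1 c)) * (\prod_h eta h (i.2 h)).
have aux (K : finType) (F : K -> R) k x : (\prod_j F j) * x = (F k * x) * \prod_(j | j != k) F j.
  by rewrite (bigD1 k) //= mulrAC.
have Eeps i c h : E i * eps c h = if i.1 c == h then E i else 0.
  rewrite {1}/E mulrAC (aux _ _ c) (epsP c).1.
  by case: eqP => _; rewrite ?mul0r // /E [in RHS](bigD1 c).
have Eeta i h c : E i * eta h c = if i.2 h == c then E i else 0.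
  rewrite {1}/E -mulrA (aux _ _ h) (etaP h).1.
  by case: eqP => _; rewrite ?mul0r ?mulr0 // /E [\prod_h0 eta h0 (i.2 h0)](bigD1 h).
have EE i j : E i * E j = if i == j then E i else 0.
  have [->|ij] := eqVneq i j.
    rewrite {2}/E mulrA.
    have -> : E j * (\prod_c eps c (j.1 c)) = E j.
      by elim/big_rec: _ => [|c x _ IH]; rewrite ?mulr1 // mulrA Eeps eqxx.
    by elim/big_rec: _ => [|c x _ IH]; rewrite ?mulr1 // mulrA Eeta eqxx.
  have [e1|ne1] := eqVneq i.1 j.1.
    have [e2|ne2] := eqVneq i.2 j.2.
      by case/eqP: ij; case: (i) (j) e1 e2 => ? ? [? ?] /= -> ->.
    have [h hh] : exists h, i.2 h != j.2 h.
      apply/existsP; rewrite -negb_forall; apply: contra ne2 => /forallP h.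
      by apply/eqP/ffunP => x; apply/eqP.
    rewrite {2}/E [\prod_h eta h (j.2 h)](bigD1 h) //= mulrCA (mulrA (E i)) Eeta.
    by rewrite (negPf hh) mul0r mulr0.
  have [c hc] : exists c, i.1 c != j.1 c.
    apply/existsP; rewrite -negb_forall; apply: contra ne1 => /forallP h.
    by apply/eqP/ffunP => x; apply/eqP.
  by rewrite {2}/E [\prod_c eps c (j.1 c)](bigD1 c) //= mulrA (mulrA (E i)) Eeps (negPf hc) !mul0r.
have Eidem i : E i * E i = E i by rewrite EE eqxx.
pose I := ({ffun C -> H} * {ffun H -> C})%type.
exists I, E, (fun (i : I) c => i.1 c), (fun (i : I) h => i.2 h); split=> //.
- rewrite -(pair_big predT predT (fun a b => E (a, b))) /E /=.
  under eq_bigr do rewrite -mulr_sumr.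
  rewrite -mulr_suml -!bigA_distr_bigA /=.
  by rewrite !big1 ?mulr1 // => i _; [case: (etaP i) | case: (epsP i)].
- move=> i c; rewrite (grading_idempotent Rord Rred R1 cH gQ (Eidem i)).
  have := Eeps i c (i.1 c); rewrite eqxx => {2}<-.
  by rewrite /eps -!mulrA [u c^-1%g * _]mulrC uhomV // mulr1.
- move=> i h; rewrite (grading_idempotent Rord Rred R1 cC gP (Eidem i)).
  have := Eeta i h (i.2 h); rewrite eqxx => {2}<-.
  by rewrite /eta -!mulrA [v h^-1%g * _]mulrC uhomV // mulr1.
Qed.
End TwoGradings.

(** * Degrees of units on one piece *)

Section LocalDegree.
Variable R : comPzRingType.
Hypothesis (Rord : is_order R) (Rred : reduced R) (R1 : (1 : R) != 0).
Variable e : R.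
Hypothesis ee : e * e = e.

Definition has_degree (G : finGroupType) (S : G -> R -> R) g x := S g (e * x) = e * x.

Section OneGrading.
Variables (G : finGroupType) (S : G -> R -> R).
Hypotheses (cG : commutative (@mulg G)) (gS : grading S).

Lemma has_degreeM g h x y :
  has_degree S g x -> has_degree S h y -> has_degree S (g * h)%g (x * y).
Proof.
by rewrite /has_degree => hx hy; have := gr_homM gS hx hy; rewrite mulrACA ee.
Qed.

Lemma has_degree_hom g x : S g x = x -> has_degree S g x.
Proof. by move=> hx; rewrite /has_degree (grading_idempotent Rord Rred R1 cG gS ee) hx. Qed.

(** The value of [w] at a product is a unit, so on the nonzero piece it does not vanish and has only
    one degree. *)
Lemma degree_ghom (K : finGroupType) (w : K -> R) (a : K -> G) : e != 0 -> uhom w ->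
  (forall k, has_degree S (a k) (w k)) -> ghom a.
Proof.
move=> e0 wM ha x y; apply/eqP; apply: contraNT e0 => ne.
have h1 := has_degreeM (ha x) (ha y); rewrite -(wM.1) in h1.
have := gr_homE gS (a x * a y)%g (ha (x * y)%g); rewrite h1 eq_sym (negPf ne) => h0.
by rewrite -[e]mulr1 -(uhomV (x * y)%g wM) mulrA h0 mul0r.
Qed.
End OneGrading.

Section TwoLocalGradings.
Variables (C H : finGroupType).
Hypotheses (cC : commutative (@mulg C)) (cH : commutative (@mulg H)).
Variables (P : C -> R -> R) (u : C -> R) (Q : H -> R -> R) (v : H -> R).
Hypotheses (gP : grading P) (gQ : grading Q) (uM : uhom u) (vM : uhom v).
Hypotheses (Pu : forall c, P c (u c) = u c) (Qv : forall h, Q h (v h) = v h).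
Variables (a : C -> H) (b : H -> C).
Hypotheses (ahom : ghom a) (bhom : ghom b).
Hypotheses (adeg : forall c, has_degree Q (a c) (u c)) (bdeg : forall h, has_degree P (b h) (v h)).

(** Let [g] invert the automorphism [c * (b (a c))^-1]. In [u (g c) * v (a (g c))^-1] the two
    degrees in [H] cancel, while the degree in [C] is that automorphism at [g c], namely [c]. *)
Lemma split_units : injective (fun c => c * (b (a c))^-1)%g ->
  exists t : C -> R, [/\ uhom t, forall c, has_degree Q 1%g (t c) & forall c, has_degree P c (t c)].
Proof.
move=> finj; pose f c := (c * (b (a c))^-1)%g.
have fhom : ghom f.
  by move=> x y; rewrite /f ahom bhom; exact: mulg_divACA.
have [g [ghm fg gf]] := inj_endo_bij erefl fhom finj.
exists (fun c => u (g c) * v (a (g c))^-1%g); split.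
- split; last by rewrite ghom1 // uM.2 ghom1 // invg1 vM.2 mulr1.
  by move=> x y; rewrite ghm ahom uM.1 invMg cH vM.1 mulrACA.
- move=> c; rewrite -(mulgV (a (g c))); apply: has_degreeM => //.
  exact: has_degree_hom.
- move=> c; rewrite -{1}(gf c) {1}/f; apply: has_degreeM => //.
    exact: has_degree_hom.
  by rewrite -ghomV.
Qed.
End TwoLocalGradings.

Section Transfer.
Variable C : finGroupType.
Hypothesis cC : commutative (@mulg C).

(* Twisting by [z] carries the degree-one part of [P] to that of [Q];
   twisting by [y] carries it back. *)
Definition unit_transfer (P Q : C -> R -> R) (z y : C -> R) (p q : C -> C) : Prop :=
  [/\ uhom z, uhom y,
      forall h, has_degree Q h^-1%g (z h) /\ has_degree P (p h) (z h),
      forall c, has_degree P c^-1%g (y c) /\ has_degree Q (q c) (y c) &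
      forall c, z c * y (p c) = 1 /\ y c * z (q c) = 1].

Lemma unit_transferC P Q z y p q : unit_transfer P Q z y p q -> unit_transfer Q P y z q p.
Proof. by case=> zM yM hz hy h; split=> // c; case: (h c). Qed.

(** With [g] inverse to [a], the units [u (g h)^-1] and [u c^-1] have the required degrees, and [p]
    and [q] pair them with their inverses. *)
Lemma transfer_inj (P Q : C -> R -> R) (u : C -> R) (a : C -> C) :
    grading P -> grading Q -> uhom u ->
    (forall c, P c (u c) = u c) ->
    ghom a -> (forall c, has_degree Q (a c) (u c)) -> injective a ->
  exists z y p q, unit_transfer P Q z y p q.
Proof.
move=> gP gQ uM Pu ahom adeg ainj.
have [g [ghm ag ga]] := inj_endo_bij erefl ahom ainj.
have VM : uhom (fun c => u c^-1%g).
  by split; [move=> x y; rewrite invMg cC uM.1 | rewrite invg1 uM.2].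
exists (fun h => u (g h)^-1%g), (fun c => u c^-1%g), (fun h => (g h)^-1%g), (fun c => a c^-1%g).
split=> //.
- by split; [move=> x y; rewrite ghm VM.1 | rewrite ghom1 // invg1 uM.2].
- move=> h; split; last exact: has_degree_hom.
  by have := adeg (g h)^-1%g; rewrite ghomV // ga.
- by move=> c; split; first exact: has_degree_hom.
- by move=> c; rewrite ag invgK; split; rewrite mulrC ?uhomV // mulrC uhomV.
Qed.

(** If neither [a] nor [b] is injective, neither composite is, so locality makes both complementary
    maps injective. The split units [t] (degree [c] for [P], 1 for [Q]) and [s] (the reverse)
    combine to [s h^-1 * t h], of degree [h^-1] for [Q] and [h] for [P]. *)
Lemma transfer_exists (P Q : C -> R -> R) (u v : C -> R) (a b : C -> C) :
    local_group C -> e != 0 ->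
    grading P -> grading Q -> uhom u -> uhom v ->
    (forall c, P c (u c) = u c) -> (forall c, Q c (v c) = v c) ->
    (forall c, has_degree Q (a c) (u c)) -> (forall h, has_degree P (b h) (v h)) ->
  exists z y p q, unit_transfer P Q z y p q.
Proof.
move=> lC e0 gP gQ uM vM Pu Qv adeg bdeg.
have ahom := degree_ghom gQ e0 uM adeg.
have bhom := degree_ghom gP e0 vM bdeg.
have [ainj|ninja] := pselect (injective a); first exact: (transfer_inj gP gQ uM Pu ahom adeg ainj).
have [binj|ninjb] := pselect (injective b).
  have [y [z [q [p]]]] := transfer_inj gQ gP vM Qv bhom bdeg binj.
  by move/unit_transferC => h; exists z, y, p, q.
have inj1 : injective (fun c => c * (b (a c))^-1)%g.
  have [|h|//] := lC (b \o a); first by move=> x y /=; rewrite ahom bhom.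
  by case: ninja => x y xy; apply: h; rewrite /= xy.
have inj2 : injective (fun c => c * (a (b c))^-1)%g.
  have [|h|//] := lC (a \o b); first by move=> x y /=; rewrite bhom ahom.
  by case: ninjb => x y xy; apply: h; rewrite /= xy.
have [t [tM tQ tP]] := split_units cC cC gP gQ uM vM Pu Qv ahom bhom adeg bdeg inj1.
have [s [sM sP sQ]] := split_units cC cC gQ gP vM uM Qv Pu bhom ahom bdeg adeg inj2.
exists (fun h => s h^-1%g * t h), (fun c => t c^-1%g * s c), id, id; split.
- split; last by rewrite invg1 sM.2 tM.2 mulr1.
  by move=> x y; rewrite invMg sM.1 [s _ * s _]mulrC tM.1 mulrACA.
- split; last by rewrite invg1 sM.2 tM.2 mulr1.
  by move=> x y; rewrite invMg tM.1 [t _ * t _]mulrC sM.1 mulrACA.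
- move=> h; split; first by rewrite -{1}[h^-1%g]mulg1; apply: has_degreeM.
  by rewrite -{1}[h]mul1g; apply: has_degreeM.
- move=> h; split; first by rewrite -{1}[h^-1%g]mulg1; apply: has_degreeM.
  by rewrite -{1}[h]mul1g; apply: has_degreeM.
- move=> c; have e1 : s c^-1%g * t c * (t c^-1%g * s c) = 1.
    by rewrite mulrA -(mulrA (s _)) uhomV // mulr1 mulrC uhomV.
  by split=> //; rewrite mulrC.
Qed.
End Transfer.
End LocalDegree.

Definition subring_of (R A : pzRingType) (i : A -> R) (S : R -> Prop) : Prop :=
  [/\ ringhom i, injective i & forall x, S x <-> exists a, i a = x].

(** * Twisting a grading by units *)

Section Twist.
Variables (R : comPzRingType) (C : finGroupType) (P Q : C -> R -> R) (z y : C -> R).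
Hypotheses (gP : grading P) (gQ : grading Q) (zM : uhom z) (yM : uhom y).
Hypothesis PQ : forall g h x, P g (Q h x) = Q h (P g x).

Definition twist (Q : C -> R -> R) (z : C -> R) x := \sum_h Q h x * z h.

Lemma twist_hom g x : Q g x = x -> twist Q z x = x * z g.
Proof.
move=> hx; rewrite /twist (bigD1 g) //= hx big1 ?addr0 // => h hg.
by rewrite (gr_homE gQ h hx) (negPf hg) mul0r.
Qed.

Lemma twistD x x' : twist Q z (x + x') = twist Q z x + twist Q z x'.
Proof. by rewrite /twist -big_split; apply: eq_bigr => h _; rewrite (grD gQ) mulrDl. Qed.

Lemma twist_ringhom : ringhom (twist Q z).
Proof.
split; first exact: twistD.
  move=> x x'; have ho h w : Q h (Q h w) = Q h w by rewrite (grP gQ) eqxx.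
  rewrite -(gr_sum gQ x) -(gr_sum gQ x') mulr_suml !(additive_map_sum twistD) mulr_suml.
  apply: eq_bigr => g _; rewrite !mulr_sumr (additive_map_sum twistD).
  apply: eq_bigr => h _; rewrite (twist_hom (gr_homM gQ (ho _ _) (ho _ _))).
  by rewrite !(twist_hom (ho _ _)) zM.1 mulrACA.
by rewrite (twist_hom (gr1 gQ)) zM.2 mulr1.
Qed.

Lemma twist_degree1 x : (forall h, Q h^-1%g (z h) = z h) -> Q 1%g (twist Q z x) = twist Q z x.
Proof.
move=> zdeg; rewrite /twist (grS gQ); apply: eq_bigr => h _.
rewrite -{1}(mulgV h); apply: (gr_homM gQ) => //; by rewrite (grP gQ) eqxx.
Qed.

(** As the gradings commute, the [Q]-components of [x] still have [P]-degree 1 and are fixed by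
    [twist P y], which sends every [z h] to 1. *)
Lemma twistK x : (forall h, twist P y (z h) = 1) -> P 1%g x = x -> ringhom (twist P y) ->
  twist P y (twist Q z x) = x.
Proof.
move=> zy hx [tD tM _].
rewrite /twist -/(twist P y _) (additive_map_sum tD) -[RHS](gr_sum gQ x); apply: eq_bigr => h _.
rewrite tM zy mulr1 /twist (bigD1 1%g) //= PQ hx yM.2 mulr1 big1 ?addr0 // => c c1.
by rewrite PQ (gr_homE gP c hx) (negPf c1) (gr0 gQ) mul0r.
Qed.
End Twist.

Lemma ring_iso_of_inverse (R A B : pzRingType) (iA : A -> R) (iB : B -> R) SA SB (f g : R -> R) :
    subring_of iA SA -> subring_of iB SB -> ringhom f ->
    (forall x, SA x -> SB (f x)) -> (forall x, SB x -> SA (g x)) ->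
    (forall x, SA x -> g (f x) = x) -> (forall x, SB x -> f (g x) = x) ->
  ring_iso A B.
Proof.
move=> [[iAD iAM iA1] iAi iAS] [[iBD iBM iB1] iBi iBS] [fD fM f1] fS gS gf fg.
have SiA a : SA (iA a) by apply/iAS; exists a.
have SiB b : SB (iB b) by apply/iBS; exists b.
have /choice[th thE] a : exists b, iB b = f (iA a) by apply/iBS/fS.
have /choice[ht htE] b : exists a, iA a = g (iB b) by apply/iAS/gS.
exists th; split.
  by exists ht => x; [apply: iAi; rewrite htE thE gf | apply: iBi; rewrite thE htE fg].
split; first by apply: iBi; rewrite thE iA1 f1 iB1.
by split=> x y; apply: iBi; [rewrite iBD !thE iAD fD | rewrite iBM !thE iAM fM].
Qed.

(** * Cancellation and exchange of an indecomposable factor *)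

Section Main.
Variable R : comPzRingType.
Hypothesis (Rord : is_order R) (Rred : reduced R) (R1 : (1 : R) != 0).

Section Glue.
Variables (I : finType) (E : I -> R).
Hypothesis E1 : \sum_i E i = 1.
Hypothesis EE : forall i j, E i * E j = if i == j then E i else 0.

Let Eid i : E i * E i = E i. Proof. by rewrite EE eqxx. Qed.

Lemma glue_uhom (C : finGroupType) (t : I -> C -> R) :
  (forall i, E i != 0 -> uhom (t i)) -> uhom (fun c => glue E (fun i => t i c)).
Proof.
move=> tM; split=> [x y|]; apply: (E_ext E1) => i /tM[tiM ti1]; last by rewrite (glueE EE) ti1.
by rewrite (glueE EE) tiM [RHS]mulrA (glueE EE) [RHS]mulrAC (glueE EE) [RHS]mulrAC mulrA.
Qed.

Lemma glue_degree (G : finGroupType) (S : G -> R -> R) g (x : I -> R) :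
    commutative (@mulg G) -> grading S ->
  (forall i, E i != 0 -> has_degree (E i) S g (x i)) -> S g (glue E x) = glue E x.
Proof.
move=> cG gS hx; apply: (E_ext E1) => i /hx; rewrite /has_degree => h.
by rewrite -(grading_idempotent Rord Rred R1 cG gS (Eid i)) (glueE EE).
Qed.

Lemma glue_twist (C : finGroupType) (P : C -> R -> R) (z : I -> R) (Y : I -> C -> R) (p : I -> C) :
    commutative (@mulg C) -> grading P ->
    (forall i, E i != 0 -> has_degree (E i) P (p i) (z i)) ->
    (forall i, E i != 0 -> z i * Y i (p i) = 1) ->
  twist P (fun c => glue E (fun i => Y i c)) (glue E z) = 1.
Proof.
move=> cC gP zdeg zY; apply: (E_ext E1) => i Ei0.
have Plin := grading_idempotent Rord Rred R1 cC gP (Eid i).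
rewrite /twist mulr_sumr (bigD1 (p i)) //= big1 ?addr0 => [|c cp].
  rewrite mulrA -Plin (glueE EE) (zdeg i Ei0) -mulrA mulrCA (glueE EE).
  by rewrite mulrCA zY.
by rewrite mulrA -Plin (glueE EE) (gr_homE gP c (zdeg i Ei0)) (negPf cp) mul0r.
Qed.
End Glue.

(** The transfers on the pieces glue to [z] and [y]. [twist Q z] maps the degree-one part of [P]
    into that of [Q] because the degree of [z h] cancels [h], and [twist P y] is its inverse
    there. *)
Theorem cancellation (C : finGroupType) (P Q : C -> R -> R) (u v : C -> R)
    (A B : pzRingType) (iA : A -> R) (iB : B -> R) :
    local_group C -> commutative (@mulg C) ->
    grading P -> grading Q -> uhom u -> uhom v ->
    (forall c, P c (u c) = u c) -> (forall c, Q c (v c) = v c) ->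
    subring_of iA (fun x => P 1%g x = x) -> subring_of iB (fun x => Q 1%g x = x) ->
  ring_iso A B.
Proof.
move=> lC cC gP gQ uM vM Pu Qv subA subB.
have [I [E [a [b [E1 EE adeg bdeg]]]]] :=
  homogeneous_partition Rord Rred R1 cC cC gP gQ uM vM.
have Eid i : E i * E i = E i by rewrite EE eqxx.
have /choice[d dP] i : exists d : (C -> R) * (C -> R) * (C -> C) * (C -> C),
    E i != 0 -> unit_transfer (E i) P Q d.1.1.1 d.1.1.2 d.1.2 d.2.
  (* Zero pieces get arbitrary values, which gluing ignores. *)
  have [Ei0|Ei0] := eqVneq (E i) 0; first by exists (u, u, id, id).
  have [z [y [p [q h]]]] :=
    transfer_exists Rord Rred R1 (Eid i) cC lC Ei0 gP gQ uM vM Pu Qv (adeg i) (bdeg i).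
  by exists (z, y, p, q).
pose z c := glue E (fun i => (d i).1.1.1 c); pose y c := glue E (fun i => (d i).1.1.2 c).
have zM : uhom z by apply: (glue_uhom E1 EE) => i /dP[].
have yM : uhom y by apply: (glue_uhom E1 EE) => i /dP[].
have zdeg h : Q h^-1%g (z h) = z h.
  by apply: (glue_degree E1 EE) => // i /dP[_ _ H _ _]; case: (H h).
have ydeg h : P h^-1%g (y h) = y h.
  by apply: (glue_degree E1 EE) => // i /dP[_ _ _ H _]; case: (H h).
have yz h : twist P y (z h) = 1.
  apply: (glue_twist E1 EE (p := fun i => (d i).1.2 h)) => // i /dP[_ _ H _ H'].
    by case: (H h).
  by case: (H' h).
have zy h : twist Q z (y h) = 1.
  apply: (glue_twist E1 EE (p := fun i => (d i).2 h)) => // i /dP[_ _ _ H H'].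
    by case: (H h).
  by case: (H' h).
have PQ := gradings_commute Rord Rred R1 cC cC gP gQ.
have QP g h x : Q g (P h x) = P h (Q g x) by rewrite PQ.
apply: (ring_iso_of_inverse subA subB (twist_ringhom gQ zM) (g := twist P y)) => x.
- by move=> _; apply: twist_degree1.
- by move=> _; apply: twist_degree1.
- by move=> hx; apply: (twistK gP gQ yM PQ yz hx); apply: twist_ringhom.
- by move=> hx; apply: (twistK gQ gP zM QP zy hx); apply: twist_ringhom.
Qed.

(** If [b i \o a i] is injective on some nonzero piece, the first alternative holds. Otherwise
    locality gives split units on every nonzero piece, and these glue. *)
Theorem exchange (C H : finGroupType) (P : C -> R -> R) (Q : H -> R -> R)
    (u : C -> R) (v : H -> R) :
    local_group C -> commutative (@mulg C) -> commutative (@mulg H) ->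
    grading P -> grading Q -> uhom u -> uhom v ->
    (forall c, P c (u c) = u c) -> (forall c, Q c (v c) = v c) ->
  (exists (a : C -> H) (b : H -> C), [/\ ghom a, ghom b & injective (b \o a)]) \/
  (exists t : C -> R, [/\ uhom t, forall c, Q 1%g (t c) = t c & forall c, P c (t c) = t c]).
Proof.
move=> lC cC cH gP gQ uM vM Pu Qv.
have [I [E [a [b [E1 EE adeg bdeg]]]]] :=
  homogeneous_partition Rord Rred R1 cC cH gP gQ uM vM.
have Eid i : E i * E i = E i by rewrite EE eqxx.
have ahom i : E i != 0 -> ghom (a i) by move=> Ei; apply: (degree_ghom (Eid i) gQ Ei uM (adeg i)).
have bhom i : E i != 0 -> ghom (b i) by move=> Ei; apply: (degree_ghom (Eid i) gP Ei vM (bdeg i)).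
have [[i [Ei iab]]|nex] := pselect (exists i, E i != 0 /\ injective (b i \o a i)).
  by left; exists (a i), (b i); split; auto.
right; have /choice[t tP] i : exists t : C -> R, E i != 0 ->
    [/\ uhom t, forall c, has_degree (E i) Q 1%g (t c) & forall c, has_degree (E i) P c (t c)].
  have [Ei0|Ei0] := eqVneq (E i) 0; first by exists u.
  have inj : injective (fun c => c * (b i (a i c))^-1)%g.
    have [|h|//] := lC (b i \o a i); first by move=> x y /=; rewrite ahom // bhom.
    by case: nex; exists i.
  have [t ht] := split_units Rord Rred R1 (Eid i) cC cH gP gQ uM vM Pu Qv
    (ahom i Ei0) (bhom i Ei0) (adeg i) (bdeg i) inj.
  by exists t.
exists (fun c => glue E (fun i => t i c)); split.
- by apply: (glue_uhom E1 EE) => i /tP[].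
- by move=> c; apply: (glue_degree E1 EE) => // i /tP[].
- by move=> c; apply: (glue_degree E1 EE) => // i /tP[].
Qed.
End Main.

(** * Group rings of finite groups as gradings *)

Lemma ListInP (T : eqType) (x : T) s : reflect (List.In x s) (x \in s).
Proof.
elim: s => [|y s IH] /=; first by constructor.
by rewrite inE eq_sym; apply: (iffP orP) => -[/eqP|/IH]; auto; move=> ->; left.
Qed.

Lemma ListNoDupP (T : eqType) (s : seq T) : reflect (List.NoDup s) (uniq s).
Proof.
elim: s => [|y s IH] /=; first by repeat constructor.
apply: (iffP andP) => [[/ListInP h /IH h']|h]; first by constructor.
by inversion h; subst; split; [apply/ListInP | apply/IH].
Qed.

Lemma inj_surj_bijective (T U : Type) (f : T -> U) :
  injective f -> (forall y, exists x, f x = y) -> bijective f.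
Proof. by move=> fi /choice[g gK]; exists g => // x; apply: fi. Qed.

Definition grp_of (gT : finGroupType) : grp :=
  @Grp gT (@mulg gT) 1%g (@invg gT) (@mulgA gT) (@mul1g gT) (@mulVg gT).

Section FiniteGroup.
Variables (G : grp) (n : nat) (f : G -> 'I_n) (g : 'I_n -> G).
Hypothesis fK : cancel f g.
Definition finite_grp : finGroupType :=
  HB.pack (can_type fK) (Finite_isGroup.Build (can_type fK) (@gmulA G) (@gmul1 G) (@gmulV G)).
End FiniteGroup.

Lemma fin_abelian_finGroup (G : grp) : fin_abelian G ->
  exists gT : finGroupType, commutative (@mulg gT) /\ grp_iso G (grp_of gT).
Proof.
case=> [[s sP] Gc].
have [f [g fK]] : exists (f : G -> 'I_(size s)) (g : 'I_(size s) -> G), cancel f g.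
  (* [{classic G}] equips [G] with decidable equality, so that positions in the list encode the
     elements. *)
  have hs (x : {classic G}) : (index x (s : seq {classic G}) < size s)%N.
    by rewrite index_mem; apply/ListInP; apply: sP.
  exists (fun x => Ordinal (hs x)), (fun i => nth gone s i) => x /=.
  by rewrite (@nth_index {classic G}) //; apply/ListInP; apply: sP.
exists (finite_grp fK); split; first exact: Gc.
by exists id; split=> //; exists id.
Qed.

Lemma grp_iso_sym (G H : grp) : grp_iso G H -> grp_iso H G.
Proof.
case=> f [[g fK gK] fM]; exists g; split; first by exists f.
by move=> x y; apply: (can_inj fK); rewrite fM !gK.
Qed.

Lemma grp_iso_trans (G H K : grp) : grp_iso G H -> grp_iso H K -> grp_iso G K.
Proof.
case=> f [bf fM] [g [bg gM]]; exists (g \o f); split; first exact: bij_comp.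
by move=> x y; rewrite /= fM gM.
Qed.

Lemma grp_iso_ghom (gT hT : finGroupType) (f : gT -> hT) :
  ghom f -> bijective f -> grp_iso (grp_of gT) (grp_of hT).
Proof. by move=> fM fb; exists f. Qed.

Lemma grp_iso_finGroup (gT hT : finGroupType) : grp_iso (grp_of gT) (grp_of hT) ->
  exists f : gT -> hT, ghom f /\ bijective f.
Proof. by case=> f [fb fM]; exists f. Qed.

Lemma ring_iso_sym (A B : pzRingType) : ring_iso A B -> ring_iso B A.
Proof.
case=> f [[g fK gK] [f1 [fD fM]]]; exists g; split; first by exists f.
by split; [rewrite -f1 fK | split=> x y; apply: (can_inj fK); rewrite ?fD ?fM !gK].
Qed.

Lemma ring_iso_trans (A B C : pzRingType) : ring_iso A B -> ring_iso B C -> ring_iso A C.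
Proof.
case=> f [bf [f1 [fD fM]]] [g [bg [g1 [gD gM]]]]; exists (g \o f).
split; first exact: bij_comp.
by split; [rewrite /= f1 | split=> x y /=; rewrite ?fD ?fM].
Qed.

Section Subring.
Variables (R : comPzRingType) (S : R -> Prop).

Definition subring_pred_of (_ : subring_closed (fun x => `[<S x>])) : {pred R} := fun x => `[<S x>].

Hypothesis S_closed : subring_closed (fun x => `[<S x>]).
Local Notation p := (subring_pred_of S_closed).
HB.instance Definition _ := GRing.isSubringClosed.Build R p S_closed.
Record subring_type := SubringElt { subring_val : R; _ : subring_val \in p }.
HB.instance Definition _ := [isSub for subring_val].
HB.instance Definition _ := [Choice of subring_type by <:].
HB.instance Definition _ := GRing.SubChoice_isSubComPzRing.Build R p subring_type S_closed.
End Subring.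

Lemma subring_exists (R : comPzRingType) (S : R -> Prop) :
    S 1 -> (forall x y, S x -> S y -> S (x - y)) -> (forall x y, S x -> S y -> S (x * y)) ->
  exists (A : comPzRingType) (i : A -> R), subring_of i S.
Proof.
move=> S1 SB SM; have h : subring_closed (fun x => `[<S x>]).
  split; [exact/asboolP | by move=> x y /asboolP hx /asboolP hy; apply/asboolP/SB |].
  by move=> x y /asboolP hx /asboolP hy; apply/asboolP/SM.
exists (subring_type h : comPzRingType), val; split.
- split; [exact: rmorphD | exact: rmorphM | exact: rmorph1].
- exact: val_inj.
move=> x; split=> [hx|[[y /= /asboolP hy] <-//]].
have hx' : x \in subring_pred_of h by apply/asboolP.
by exists (SubringElt hx').
Qed.

Definition com_pzRing (A : pzRingType) (mC : commutative (@GRing.mul A)) : comPzRingType :=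
  HB.pack (GRing.PzRing.sort A) (GRing.PzRing_hasCommutativeMul.Build A mC).

(** An equality of structures, so that properties of [A] such as starkness transfer by rewriting. *)
Lemma com_pzRingE (A : pzRingType) (mC : commutative (@GRing.mul A)) :
  com_pzRing mC = A :> pzRingType.
Proof. by case: A mC => T [*]. Qed.

Lemma gr_conv (R : comPzRingType) (gT : finGroupType) (P : gT -> R -> R) (r t : R) x :
  grading P -> P x (r * t) = \sum_y P y r * P (y^-1 * x)%g t.
Proof.
move=> gP; rewrite -{1}(gr_sum gP r) mulr_suml (grS gP); apply: eq_bigr => y _.
rewrite -{1}(gr_sum gP t) mulr_sumr (grS gP) (bigD1 (y^-1 * x)%g) //=.
have ho h w : P h (P h w) = P h w by rewrite (grP gP) eqxx.
rewrite (gr_homE gP x (gr_homM gP (ho _ _) (ho _ _))) mulKVg eqxx.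
rewrite big1 ?addr0 // => h hy.
rewrite (gr_homE gP x (gr_homM gP (ho _ _) (ho _ _))); case: eqP => // xE.
by rewrite xE mulKg eqxx in hy.
Qed.

(* [R] is the group ring over its degree-one part: a grading with a unit in each degree. *)
Definition internal_grpring (R : comPzRingType) (A : pzRingType) (gT : finGroupType) : Prop :=
  exists (i : A -> R) (P : gT -> R -> R) (u : gT -> R),
    [/\ grading P, uhom u, forall g, P g (u g) = u g & subring_of i (fun x => P 1%g x = x)].

(** The coefficient of [r] at [g] is the component of degree [g], moved to degree one by [u g^-1].
    Conversely the elements [D (a, g)], supported at [g] with value [a], supply the embedding, the
    projections and the units. *)
Lemma internal_grpringP (R : comPzRingType) (A : pzRingType) (gT : finGroupType) :
  internal_grpring R A gT <-> grpring_iso R A (grp_of gT).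
Proof.
split.
  case=> i [P [u [gP uM Pu [[iD iM i1] iinj iS]]]].
  have ho h w : P h (P h w) = P h w by rewrite (grP gP) eqxx.
  have /choice[phi phiE] (r : R) : exists p : gT -> A, forall g, i (p g) = P g r * u g^-1%g.
    suff /choice[p pE] g : exists a, i a = P g r * u g^-1%g by exists p.
    by apply/iS; rewrite -{1}(mulgV g); apply: (gr_homM gP).
  have i0 := additive_map0 iD.
  have PE r g : P g r = i (phi r g) * u g.
    by rewrite phiE -mulrA [u _ * u g]mulrC uhomV // mulr1.
  exists phi; split.
  - split; last by move=> r; exists (enum gT) => g _; apply/ListInP; rewrite mem_enum.
    move=> r s rs; rewrite -(gr_sum gP r) -(gr_sum gP s).
    by apply: eq_bigr => g _; rewrite !PE rs.
  - move=> f _; exists (\sum_g i (f g) * u g); apply: funext => g.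
    apply: iinj; rewrite phiE (grS gP) (bigD1 g) //=.
    have deg h : P h (i (f h) * u h) = i (f h) * u h.
      rewrite -{1}[h]mul1g; apply: (gr_homM gP) => //; apply/iS; by exists (f h).
    rewrite deg big1 ?addr0 => [|h hg]; first by rewrite -mulrA uhomV // mulr1.
    by rewrite (gr_homE gP g (deg h)) eq_sym (negPf hg).
  - by move=> r s g; apply: iinj; rewrite iD !phiE (grD gP) mulrDl.
  - split=> [|g g1]; apply: iinj; rewrite phiE; first by rewrite (gr1 gP) invg1 uM.2 mulr1 i1.
    by rewrite i0 (gr_homE gP g (gr1 gP)); case: eqP => //; rewrite mul0r.
  move=> r t s /ListNoDupP us hs x; apply: iinj.
  rewrite phiE (gr_conv _ _ _ gP) (additive_map_sum iD) (big_uniq _ us) /=.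
  rewrite [in RHS]big_mkcond /= mulr_suml.
  apply: eq_bigr => y _; case: ifPn => [_|ys].
    rewrite iM !phiE invMg invgK uM.1 mulrACA; congr (_ * _).
    by rewrite mulrCA [u y^-1%g * _]mulrC uhomV // mulr1.
  have r0 : phi r y = 0 by apply/eqP; apply: contraNT ys => /hs /ListInP.
  by rewrite PE r0 i0 !mul0r.
case=> phi [[phi_inj _] phi_surj phiD [phi1 phi1'] phiM].
have phiM' r t x : phi (r * t) x = \sum_(y : gT) phi r y * phi t (y^-1 * x)%g.
  rewrite (phiM r t (enum gT)) ?big_enum //.
    exact/ListNoDupP/enum_uniq.
  by move=> g _; apply/ListInP; rewrite mem_enum.
have phi0 g : phi 0 g = 0.
  exact: (additive_map0 (f := phi^~ g) (fun r s => phiD r s g)).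
have /choice[D DE] (ag : A * gT) : exists r, forall x : gT, phi r x = if x == ag.2 then ag.1 else 0.
  have [|r rE] := phi_surj (fun x : gT => if x == ag.2 then ag.1 else 0).
    by exists (enum gT) => x _; apply/ListInP; rewrite mem_enum.
  by exists r => x; rewrite rE.
have ext r s : (forall x : gT, phi r x = phi s x) -> r = s.
  by move=> h; apply: phi_inj; apply: funext.
have DM a b g h : D (a, g) * D (b, h) = D (a * b, (g * h)%g).
  apply: ext => x; rewrite phiM' (bigD1 g) //= !DE /= eqxx big1 ?addr0 => [|y yg].
    rewrite -(inj_eq (mulgI g)) mulKVg; case: eqP => // _; by rewrite mulr0.
  by rewrite DE /= (negPf yg) mul0r.
have D0 g : D (0, g) = 0 by apply: ext => x; rewrite DE phi0 /=; case: eqP.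
have DD a b g : D (a + b, g) = D (a, g) + D (b, g).
  by apply: ext => x; rewrite phiD !DE /=; case: eqP; rewrite ?addr0.
have D1 : D (1, 1%g) = 1.
  by apply: ext => x; rewrite DE /=; case: eqP => [->|/phi1' ->].
exists (fun a => D (a, 1%g)), (fun g r => D (phi r g, g)), (fun g => D (1, g)).
split.
- split.
  + by move=> g x y; rewrite phiD DD.
  + by move=> g h x; rewrite DE /=; case: eqP => [->//|_]; rewrite D0.
  + move=> x; apply: ext => g; rewrite (additive_map_sum (f := phi^~ g) (fun r s => phiD r s g)).
    rewrite (bigD1 g) //= DE /= eqxx big1 ?addr0 // => h hg.
    by rewrite DE /= eq_sym (negPf hg).
  + by move=> g h x y; rewrite DM DE /= eqxx.
  + by rewrite phi1.
- by split=> [x y|//]; rewrite DM mulr1.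
- by move=> g; rewrite DE eqxx.
- split.
  + by split=> // x y; rewrite ?DD // DM mulg1.
  + move=> a b /(congr1 (fun r => phi r 1%g)); by rewrite !DE /= eqxx.
  + move=> x; split=> [<-|[a <-]]; first by eexists.
    by rewrite DE /= eqxx.
Qed.

Lemma grpring_iso_grp (R A : pzRingType) (G H : grp) :
  grp_iso H G -> grpring_iso R A G -> grpring_iso R A H.
Proof.
move=> [k [[l kK lK] kM]] [phi [[phi_inj phi_fin] phi_surj phiD [phi1 phi1'] phiM]].
have k1 : k gone = gone.
  rewrite -[LHS](@gmul1 G) -(@gmulV G (k gone)) -gmulA -kM gmul1 gmulV //.
have kV x : k (ginv x) = ginv (k x).
  have gmulV' (y : G) : gmul y (ginv y) = gone.
    rewrite -[LHS]gmul1 -{1}(gmulV (ginv y)) -gmulA (gmulA (ginv y)) gmulV gmul1 gmulV //.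
  have gmul1' (y : G) : gmul y gone = y by rewrite -(gmulV y) gmulA gmulV' gmul1.
  by rewrite -[LHS]gmul1' -(gmulV' (k x)) gmulA -kM gmulV k1 gmul1.
exists (fun r h => phi r (k h)); split.
- split=> [r s rs|r].
    by apply: phi_inj; apply: funext => g; rewrite -(lK g); have := congr1 (fun f => f (l g)) rs.
  have [s sP] := phi_fin r; exists (List.map l s) => h /sP hs.
  by rewrite -(kK h); apply: List.in_map.
- move=> f [s sP]; have [|r rE] := phi_surj (f \o l).
    by exists (List.map k s) => g /= /sP hs; rewrite -(lK g); apply: List.in_map.
  by exists r; rewrite rE; apply: funext => h /=; rewrite kK.
- by move=> r s h; rewrite phiD.
- split; first by rewrite k1.
  by move=> h h1; apply: phi1' => kh; apply: h1; rewrite -(kK h) kh -k1 kK.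
- move=> r t s us hs x; rewrite (phiM r t (List.map k s)).
  + have -> : List.map k s = [seq k y | y <- s] by [].
    by rewrite big_map; apply: eq_bigr => y _; rewrite kM kV.
  + by apply: FinFun.Injective_map_NoDup => // a b; apply: (can_inj kK).
  + by move=> g; rewrite -{1}(lK g) => /hs h; rewrite -(lK g); apply: List.in_map.
Qed.

(** * Splitting off an indecomposable factor *)

Lemma subgroup_exists (gT : finGroupType) (S : pred gT) :
    S 1%g -> (forall x y, S x -> S y -> S (x * y)%g) ->
  exists (kT : finGroupType) (j : kT -> gT),
    [/\ ghom j, injective j & forall g, S g <-> exists k, j k = g].
Proof.
move=> S1 SM; have gS : group_set [set x | S x].
  by apply/group_setP; split=> [|x y]; rewrite !inE //; apply: SM.
exists (subg_of (Group gS)), (@sgval _ _); split.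
- by move=> x y; rewrite sgvalM ?inE.
- exact: subg_inj.
move=> g; split=> [Sg|[k <-]]; last by have := subgP k; rewrite inE.
by exists (subg (Group gS) g); rewrite subgK // inE.
Qed.

(** By pigeonhole the iterates of [f] are periodic with period [d] from [i] on; a positive multiple
    of [d] that is at least [i] works. *)
Lemma iter_idempotent (T : finType) (f : T -> T) :
  exists2 N, (0 < N)%N & forall x, iter N f (iter N f x) = iter N f x.
Proof.
pose F (k : 'I_(#|{: {ffun T -> T}}|.+1)) : {ffun T -> T} := [ffun x => iter k f x].
have [i [j [ij Fij]]] : exists i j : nat, (i < j)%N /\ forall x, iter i f x = iter j f x.
  have /injectivePn[a [b ab Fab]] : ~~ injectiveb F.
    by apply/negP => /injectiveP/leq_card; rewrite card_ord ltnn.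
  have E x : iter a f x = iter b f x by have /ffunP/(_ x) := Fab; rewrite !ffunE.
  have [ltab|leba] := ltnP a b; first by exists a, b.
  exists b, a; split=> //; rewrite ltn_neqAle leba andbT; apply: contra ab.
  by move/eqP => e; apply/eqP/val_inj.
pose d := (j - i)%N; have d0 : (0 < d)%N by rewrite subn_gt0.
have per t k x : (i <= k)%N -> iter (k + t * d) f x = iter k f x.
  move=> ik; elim: t => [|t IH]; first by rewrite mul0n addn0.
  rewrite -IH mulSn; have -> : (k + (d + t * d) = (k - i + t * d) + j)%N.
    rewrite -{1}(subnK ik) -[X in _ = (_ + X)%N](subnK (ltnW ij)) -/d.
    by rewrite (addnC d) addnACA (addnC i).
  by rewrite iterD -Fij -iterD addnAC subnK.
exists (i.+1 * d)%N; first by rewrite muln_gt0.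
by move=> x; rewrite -iterD per // (leq_trans (leqnSn i)) // leq_pmulr.
Qed.

Definition retract (gT cT : finGroupType) (r : gT -> cT) (s : cT -> gT) : Prop :=
  [/\ ghom r, ghom s & cancel s r].

Lemma ghom_injective (C H : finGroupType) (a : C -> H) : ghom a ->
  (forall x, a x = 1%g -> x = 1%g) -> injective a.
Proof.
move=> ha h x y xy; apply/eqP; rewrite eq_mulgV1; apply/eqP/h.
by rewrite ha ghomV // xy mulgV.
Qed.

(* A non-local group has an endomorphism with an idempotent power that is
   neither trivial nor the identity; its image is a smaller retract. *)
Lemma local_retract (gT : finGroupType) : commutative (@mulg gT) -> (1 < #|gT|)%N ->
  exists (cT : finGroupType) (r : gT -> cT) (s : cT -> gT),
    [/\ retract r s, local_group cT, commutative (@mulg cT) & (1 < #|cT|)%N].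
Proof.
have [n] := ubnP #|gT|; elim: n => // n IH in gT *; rewrite ltnS => gn cG G1.
have [loc|nloc] := pselect (local_group gT).
  by exists gT, id, id; split.
have [f [fM nf1 nf2]] : exists f : gT -> gT, [/\ ghom f, ~ injective f &
    ~ injective (fun x => x * (f x)^-1)%g].
  move: nloc; rewrite /local_group => /existsNP[f /not_implyP[fM /not_orP[h1 h2]]].
  by exists f.
have [N N0 idem] := iter_idempotent f; pose e := iter N f.
have iM k : ghom (iter k f) by elim: k => // k IHk x y; rewrite !iterS IHk fM.
(* A nontrivial element of the kernel of [x * (f x)^-1] is a fixed point of [f]. *)
have [x [x1 fx]] : exists x, x != 1%g /\ f x = x.
  apply: contra_notP nf2 => h; apply: ghom_injective.
    by move=> x y; rewrite fM; exact: mulg_divACA.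
  move=> x xf; apply: contra_notP h => x1; exists x; split; first exact/eqP.
  by apply/eqP; rewrite eq_sym eq_mulgV1 xf.
have ex : e x = x by rewrite /e; elim: (N) => // k IHk; rewrite iterS IHk.
have nei : ~ injective e.
  move=> ei; apply: nf1 => y z yz; apply: ei.
  by rewrite /e -(prednK N0) !iterSr yz.
have [kT [j [jM ji jS]]] := @subgroup_exists gT (fun g => e g == g) (introT eqP (ghom1 (iM N)))
  (fun y z (hy : e y == y) (hz : e z == z) => introT eqP
     (etrans (iM N y z) (congr2 _ (eqP hy) (eqP hz)))).
have eE y : exists k, j k = e y by apply/jS; rewrite /e idem.
have {eE} /choice[r rE] := eE.
have rj : retract r j.
  split=> [y z||k]; [apply: ji|exact: jM|apply: ji].
    by rewrite jM !rE; apply: iM.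
  by rewrite rE; apply/eqP/jS; exists k.
(* The image of [e] is proper: otherwise [e], being idempotent, would be the identity and so
   injective. *)
have kn : (#|kT| < n)%N.
  apply: leq_trans _ gn; rewrite ltn_neqAle (leq_card j ji) andbT.
  apply/eqP => kg; have [j' _ j'K] : bijective j by apply: inj_card_bij; rewrite ?kg.
  apply: nei => y z; have fixe w : e w = w by apply/eqP/jS; exists (j' w); rewrite j'K.
  by rewrite !fixe.
have k1 : (1 < #|kT|)%N.
  have [k kx] : exists k, j k = x by apply/jS; rewrite ex.
  rewrite (cardD1 1%g) (cardD1 k) !inE; case: eqP => // kE.
  by case/eqP: x1; rewrite -kx kE ghom1.
have [||cT [r' [s' [[r'M s'M r's'] lc cc c1]]]] := IH kT kn.
- by move=> y z; apply: ji; rewrite !jM cG.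
- exact: k1.
exists cT, (r' \o r), (j \o s'); case: rj => rM _ rjK; split=> //.
split=> [y z|y z|y] /=; rewrite ?rM ?r'M ?s'M ?jM //.
by rewrite rjK r's'.
Qed.

(** The group is the internal direct product of the image of [s] and the kernel of [r]: the first
    component of [g] is [s (r g)]. *)
Lemma retract_product (gT cT : finGroupType) (r : gT -> cT) (s : cT -> gT) :
    commutative (@mulg gT) -> retract r s ->
  exists (kT : finGroupType) (j : kT -> gT),
    [/\ ghom j, injective j, forall g, r g = 1%g <-> (exists k, j k = g),
        commutative (@mulg kT) & grp_iso (grp_of (cT * kT)%type) (grp_of gT)].
Proof.
move=> cG [rM sM sK].
have [|kT [j [jM ji jS]]] := @subgroup_exists gT (fun g => r g == 1%g) (introT eqP (ghom1 rM)).
  by move=> x y /eqP rx /eqP ry; rewrite rM rx ry mulg1.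
have jS' g : r g = 1%g <-> exists k, j k = g.
  by rewrite -jS; split=> [->|/eqP].
exists kT, j; split=> //; first by move=> y z; apply: ji; rewrite !jM cG.
apply: (@grp_iso_ghom _ _ (fun ck : (cT * kT)%type => s ck.1 * j ck.2)%g).
  move=> [c k] [c' k'] /=; rewrite sM jM -!mulgA; congr (_ * _)%g.
  by rewrite !mulgA; congr (_ * _)%g; rewrite cG.
have rj k : r (j k) = 1%g by apply/jS'; exists k.
apply: inj_surj_bijective => [[c k] [c' k'] /= e|g].
  have cc : c = c' by have := congr1 r e; rewrite !rM !rj !sK !mulg1.
  by move: e; rewrite cc => /mulgI/ji ->.
have [k kE] : exists k, j k = ((s (r g))^-1 * g)%g.
  by apply/jS'; rewrite rM ghomV // sK mulVg.
by exists (r g, k); rewrite /= kE mulKVg.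
Qed.

Lemma grp_iso_prod (cT kT lT : finGroupType) : grp_iso (grp_of kT) (grp_of lT) ->
  grp_iso (grp_of (cT * kT)%type) (grp_of (cT * lT)%type).
Proof.
move/grp_iso_finGroup => [f [fM [g fK gK]]].
apply: (@grp_iso_ghom _ _ (fun x : (cT * kT)%type => (x.1, f x.2))).
  by move=> [a b] [a' b'] /=; rewrite fM.
by exists (fun x => (x.1, g x.2)) => -[a b] /=; rewrite ?fK ?gK.
Qed.

(** * Coefficient rings *)

(** [A] is a direct summand of the lattice [R]. If the Smith form [L *m D *m M] represents [i \o s],
    the entries of [f (i a) *m L] at the nonzero diagonal entries of [D] are free coordinates on
    [A]. *)
Lemma is_order_retract (R A : comPzRingType) (i : A -> R) (s : R -> A) :
    is_order R -> (forall x y, i (x + y) = i x + i y) -> (forall x y, s (x + y) = s x + s y) ->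
  cancel i s -> is_order A.
Proof.
move=> [n [f [fbij fD]]] iD sD iK; have [g fK gK] := fbij.
have gD x y : g (x + y) = g x + g y by apply: (can_inj fK); rewrite fD !gK.
have [|E hE] := @additive_matrix n n (fun v => f (i (s (g v)))).
  by move=> x y; rewrite gD sD iD fD.
have [L Lu [M Mu [d _ ED]]] := int_Smith_normal_form E.
set D := \matrix_(_, _) _ in ED.
have fiE a : f (i a) *m E = f (i a) by rewrite -hE fK iK.
have DE (w : 'rV[int]_n) j : (w *m D) 0 j = w 0 j * d`_j.
  rewrite mxE (bigD1 j) //= mxE eqxx mulr1n big1 ?addr0 // => k kj.
  by rewrite mxE; case: eqP => [/val_inj e|_]; [rewrite e eqxx in kj | rewrite mulr0].
pose J := [pred j : 'I_n | d`_j != 0].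
pose h a : 'rV[int]_#|J| := \row_k (f (i a) *m L) 0 (enum_val k).
exists #|J|, h; split; last first.
  move=> x y; apply/rowP => k; rewrite [LHS]mxE iD fD mulmxDl [LHS]mxE [RHS]mxE.
  by congr (_ + _); rewrite [RHS]mxE.
have eqD (w w' : 'rV[int]_n) : (forall j : 'I_n, d`_j != 0 -> w 0 j = w' 0 j) -> w *m D = w' *m D.
  by move=> e; apply/rowP => j; rewrite !DE; have [->|/e ->] := eqVneq d`_j 0; rewrite ?mulr0.
apply: inj_surj_bijective => [a b /rowP ab|c].
  apply: (can_inj iK); apply: (can_inj fK).
  rewrite -(fiE a) -(fiE b) ED !mulmxA; congr (_ *m M); apply: eqD => j dj.
  have jJ : j \in J by [].
  by have := ab (enum_rank_in jJ j); rewrite [LHS]mxE [RHS]mxE enum_rankK_in.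
(* The preimage of [c]: extend by zero outside [J], undo [L], project to [A]. *)
pose w : 'rV[int]_n := \row_j (if [pick k | enum_val k == j] is Some k then c 0 k else 0).
pose a := s (g (w *m invmx L)); exists a; apply/rowP => k; rewrite mxE.
have faE : f (i a) = w *m D *m M by rewrite /a hE ED !mulmxA mulmxKV.
have : f (i a) *m L *m D = w *m D.
  by apply: (can_inj (mulmxK Mu)); rewrite -faE -[RHS]fiE ED !mulmxA.
move/rowP/(_ (enum_val k)); rewrite !DE => /mulIf ->; last by have := enum_valP k.
rewrite mxE; case: pickP => [k' /eqP/enum_val_inj -> //|/(_ k)]; by rewrite eqxx.
Qed.

Lemma integer_relation m n (M : 'M[int]_(m, n)) : (n < m)%N ->
  exists2 w : 'rV[int]_m, w != 0 & w *m M = 0.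
Proof.
move=> nm; have [L Lu [K Ku [d _ ->]]] := int_Smith_normal_form M.
(* Row [n] of the Smith form has no diagonal entry, hence is zero. *)
pose i : 'I_m := Ordinal nm; exists (row i (invmx L)).
  apply/eqP => e; have : row i (invmx L) *m L = 0 by rewrite e mul0mx.
  rewrite -row_mul mulVmx // => /rowP/(_ i); rewrite !mxE eqxx => /eqP.
  by rewrite oner_eq0.
rewrite rowE !mulmxA mulmxKV // -rowE.
suff -> : row i (\matrix_(i, j) (d`_i *+ (i == j :> nat))) = 0 :> 'rV[int]_n by rewrite mul0mx.
by apply/rowP => j; rewrite !mxE gtn_eqF //= ltn_ord.
Qed.

(** * The rank bounds the group *)

Section Bound.
Variables (R A : pzRingType) (G : grp) (phi : R -> G -> A).
Hypothesis phiP : is_grpring_iso phi.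

Lemma grpring_delta (g : G) : exists r, forall x, phi r x = if `[<x = g>] then 1 else 0.
Proof.
case: phiP => _ phi_surj _ _ _.
have [|r rE] := phi_surj (fun x => if `[<x = g>] then 1 else 0); last by exists r; rewrite rE.
by exists [:: g] => x; case: asboolP => [->|_]; rewrite ?eqxx //; left.
Qed.

Let phiD g r s : phi (r + s) g = phi r g + phi s g.
Proof. by case: phiP. Qed.

Lemma grpring_one_neq0 : (1 : R) != 0 -> (1 : A) != 0.
Proof.
case: phiP => [[phi_inj _]] _ _ [phi1 phi1'] _; apply: contra => /eqP A0; apply/eqP.
apply: phi_inj; apply: funext => g; rewrite (additive_map0 (phiD g)).
have [->|/phi1' //] := pselect (g = gone); by rewrite phi1.
Qed.

(** More than [n] group elements would satisfy an integer relation in a lattice of rank [n]. A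
    nonzero coefficient of it would kill 1 in [A], hence 1 in [R], against torsion-freeness. *)
Lemma grpring_bound n (f : R -> 'rV[int]_n) (s : seq G) :
    (1 : R) != 0 -> bijective f -> (forall x y, f (x + y) = f x + f y) ->
  List.NoDup s -> (size s <= n)%N.
Proof.
move=> R1 fbij fD us; rewrite leqNgt; apply/negP => ns.
have {us} us : uniq (s : seq {classic G}) by apply/ListNoDupP.
have fZ x (m : int) : f (x *~ m) = m *: f x.
  by rewrite (additive_mapMz fD) -scaler_int intz.
have /choice[r rE] := grpring_delta.
pose M : 'M[int]_(size s, n) := \matrix_i f (r (nth gone s i)).
have [w w0 wM] := integer_relation M ns.
have [j wj] : exists j, w 0 j != 0.
  apply/existsP; rewrite -negb_forall; apply: contra w0 => /forallP h.
  by apply/eqP/rowP => j; rewrite mxE; apply/eqP.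
have rel : \sum_(i < size s) r (nth gone s i) *~ w 0 i = 0.
  apply: (bij_inj fbij); rewrite (additive_map0 fD) -[RHS]wM mulmx_sum_row (additive_map_sum fD).
  by apply: eq_bigr => i _; rewrite fZ rowK.
have A0 : (1 : A) *~ w 0 j = 0.
  have := congr1 (fun x => phi x (nth gone s j)) rel.
  rewrite (additive_map0 (phiD _)) (additive_map_sum (f := phi^~ _) (phiD _)).
  rewrite (bigD1 j) //= big1 ?addr0 => [|i ij].
    by rewrite (additive_mapMz (f := phi^~ _) (phiD _)) rE asboolT.
  rewrite (additive_mapMz (f := phi^~ _) (phiD _)) rE asboolF ?mul0rz // => e; case/negP: ij.
  have := @nth_uniq {classic G} gone s j i (ltn_ord j) (ltn_ord i) us.
  by rewrite e eqxx eq_sym => /esym.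
have R0 : (1 : R) *~ w 0 j = 0.
  case: phiP => [[phi_inj _]] _ _ [phi1 phi1'] _.
  apply: phi_inj; apply: funext => g.
  rewrite (additive_mapMz (f := phi^~ _) (phiD _)) (additive_map0 (phiD _)).
  by have [->|/phi1' ->] := pselect (g = gone); rewrite ?phi1 // mul0rz.
have : w 0 j *: f 1 = 0 by rewrite -fZ R0 (additive_map0 fD).
move/rowP => h; case/eqP: R1; apply: (bij_inj fbij); rewrite (additive_map0 fD); apply/rowP => k.
by have := h k; rewrite !mxE => /eqP; rewrite mulf_eq0 (negPf wj) /= => /eqP.
Qed.

Lemma finite_of_bound (T : Type) n :
  (forall s : seq T, List.NoDup s -> (size s <= n)%N) -> exists s : seq T, forall x, List.In x s.
Proof.
move=> h; suff ext k : (k <= n)%N -> (exists s : seq T, forall x, List.In x s) \/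
    exists s : seq T, List.NoDup s /\ size s = k.
  have [//|[s [us sn]]] := ext n (leqnn n).
  exists s => x; apply: contrapT => xs; have := h (x :: s).
  by rewrite /= sn ltnn => e; have : false by apply: e; constructor.
elim: k => [_|k IH kn]; first by right; exists [::]; split=> //; constructor.
have [|[s [us sk]]] := IH (ltnW kn); first by left.
have [|/existsNP[x xs]] := pselect (forall x, List.In x s); first by left; exists s.
by right; exists (x :: s); rewrite /= sk; split=> //; constructor.
Qed.

(** The group is arbitrary here. Its size is bounded by the rank, and comparing the two products of
    the basis elements at [x] and [y] shows that these commute. *)
Lemma grpring_finite_abelian : commutative (@GRing.mul R) -> (1 : R) != 0 ->
    (exists n (f : R -> 'rV[int]_n), bijective f /\ forall x y, f (x + y) = f x + f y) ->
  fin_abelian G.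
Proof.
move=> mC R1 [n [f [fbij fD]]]; split.
  by apply: (@finite_of_bound _ n) => s; exact: (grpring_bound R1 fbij fD).
move=> x y; have /choice[r rE] := grpring_delta.
have A1 := grpring_one_neq0 R1.
have rM a b z : phi (r a * r b) z = if `[<gmul (ginv a) z = b>] then 1 else 0.
  case: phiP => _ _ _ _ phiM; rewrite (phiM _ _ [:: a]).
  - by rewrite big_seq1 !rE asboolT // mul1r.
  - by constructor => //; constructor.
  - by move=> g; rewrite rE; case: asboolP => [->|_]; rewrite ?eqxx //; left.
have gK a b : gmul (ginv a) (gmul a b) = b :> G by rewrite gmulA gmulV gmul1.
have := rM x y (gmul x y); rewrite mC rM gK (asboolT (erefl y)).
case: asboolP => [e _|_ /eqP]; last by rewrite eq_sym (negPf A1).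
have gmulV' (a : G) : gmul a (ginv a) = gone.
  by rewrite -[LHS]gmul1 -{1}(gmulV (ginv a)) -gmulA (gmulA (ginv a)) gmulV gmul1 gmulV.
by rewrite -{2}e gmulA gmulV' gmul1.
Qed.
End Bound.

Lemma grpring_iso_ring (R S A : pzRingType) (G : grp) :
  ring_iso S R -> grpring_iso R A G -> grpring_iso S A G.
Proof.
move=> [f [fb [f1 [fD fM]]]] [phi [[phi_inj phi_fin] phi_surj phiD phi1 phiM]].
have [g fK gK] := fb; exists (phi \o f); split.
- by split=> [r s|r]; [move/phi_inj/(bij_inj fb) | apply: phi_fin].
- by move=> h /phi_surj[r <-]; exists (g r); rewrite /= gK.
- by move=> r s x; rewrite /= fD phiD.
- by rewrite /= f1.
- by move=> r t s us hs x; rewrite /= fM; apply: phiM.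
Qed.

(** The components are assumed to sum to [x] only for [x] in [SB]; this covers a grading of [R] cut
    down to the degrees in a subgroup. *)
Lemma internal_grpring_restrict (R B : comPzRingType) (A : pzRingType) (gT : finGroupType)
    (iB : B -> R) (iA : A -> R) (SA SB : R -> Prop) (P : gT -> R -> R) (t : gT -> R) :
    subring_of iB SB -> subring_of iA SA -> (forall x, SA x <-> SB x /\ P 1%g x = x) ->
    (forall g x y, P g (x + y) = P g x + P g y) ->
    (forall g h x, P g (P h x) = if g == h then P h x else 0) ->
    (forall x, SB x -> \sum_g P g x = x) ->
    (forall g h x y, P (g * h)%g (P g x * P h y) = P g x * P h y) ->
    P 1%g 1 = 1 -> (forall g x, SB x -> SB (P g x)) ->
    uhom t -> (forall g, SB (t g)) -> (forall g, P g (t g) = t g) ->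
  internal_grpring B A gT.
Proof.
move=> [[iBD iBM iB1] iBi iBS] [[iAD iAM iA1] iAi iAS] SAB PD PP Psum PM P1 PS tM tS Pt.
have SiB b : SB (iB b) by apply/iBS; exists b.
have /choice[k kE] a : exists b, iB b = iA a.
  have [h _] : SB (iA a) /\ P 1%g (iA a) = iA a by apply/SAB/iAS; exists a.
  exact/iBS.
have /choice[w wE] g : exists b, iB b = t g by apply/iBS.
have /choice[Q' QE'] (gb : gT * B) : exists b, iB b = P gb.1 (iB gb.2) by apply/iBS/PS.
pose Q g b := Q' (g, b); have QE g b : iB (Q g b) = P g (iB b) by rewrite /Q QE'.
have iB0 := additive_map0 iBD.
exists k, Q, w; split.
- split=> [g x y|g h x|x|g h x y|]; apply: iBi.
  + by rewrite iBD !QE iBD PD.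
  + by rewrite !QE PP; case: eqP; rewrite ?QE ?iB0.
  + rewrite (additive_map_sum iBD) -[RHS]Psum //; by apply: eq_bigr => g _; rewrite QE.
  + by rewrite QE iBM !QE PM.
  + by rewrite QE iB1 P1.
- by split=> [x y|]; apply: iBi; rewrite ?iBM !wE ?iB1; case: tM.
- by move=> g; apply: iBi; rewrite QE wE Pt.
- split.
  + by split=> [x y|x y|]; apply: iBi; rewrite ?iBD ?iBM !kE ?iB1 ?iAD ?iAM.
  + by move=> x y /(congr1 iB); rewrite !kE => /iAi.
  + move=> x; split=> [Qx|[a <-]].
      have [a aE] : exists a, iA a = iB x by apply/iAS/SAB; split=> //; rewrite -QE Qx.
      by exists a; apply: iBi; rewrite kE.
    apply: iBi; rewrite QE kE.
    by have /SAB[] : SA (iA a) by apply/iAS; exists a.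
Qed.

Lemma card_gt1_nontrivial (gT : finGroupType) : (1 < #|gT|)%N <-> grp_nontrivial (grp_of gT).
Proof.
split=> [g1|[g /eqP g1]].
  have [g] : exists g : gT, g != 1%g.
    apply/existsP; rewrite -negb_forall; apply/negP => /forallP h.
    by move: g1; rewrite (cardD1 1%g) eq_card0 // => x; rewrite !inE h.
  by move/eqP; exists g.
by rewrite (cardD1 (1%g : gT)) (cardD1 (g : gT)) !inE g1.
Qed.

Lemma card_le1_eq1 (gT : finGroupType) (g : gT) : (#|gT| <= 1)%N -> g = 1%g.
Proof.
move=> g1; apply/eqP; apply: contraTT g1 => ne; rewrite -ltnNge.
by apply/card_gt1_nontrivial; exists g; apply/eqP.
Qed.

(** As the gradings commute, [P] restricts to [B], the degree-one part of [Q]; with the units [t] in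
    every degree, [B] is a group ring over [C]. *)
Lemma not_stark_of_units (R B : comPzRingType) (C H : finGroupType) (iB : B -> R)
    (P : C -> R -> R) (Q : H -> R -> R) (t : C -> R) :
    grading P -> grading Q -> (forall g h x, P g (Q h x) = Q h (P g x)) ->
    subring_of iB (fun x => Q 1%g x = x) -> (1 < #|C|)%N ->
    uhom t -> (forall c, Q 1%g (t c) = t c) -> (forall c, P c (t c) = t c) ->
  ~ stark B.
Proof.
move=> gP gQ PQ subB C1 tM Qt Pt; apply; pose S x := Q 1%g x = x /\ P 1%g x = x.
have grMul (G : finGroupType) (T : G -> R -> R) (gT : grading T) x y :
    T 1%g x = x -> T 1%g y = y -> T 1%g (x * y) = x * y.
  by move=> hx hy; have := gr_homM gT hx hy; rewrite mulg1.
have [|x y [hx hx'] [hy hy']|x y [hx hx'] [hy hy']|A [iA subA]] := @subring_exists R S.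
- by split; apply: gr1.
- by split; apply: gr_homB.
- by split; apply: grMul.
exists A, (grp_of C); split; first exact/card_gt1_nontrivial.
apply/internal_grpringP.
apply: (internal_grpring_restrict (iB := iB) (iA := iA) (P := P) (t := t) subB subA) => //;
  try solve [by case: gP].
by move=> g x hx; rewrite -PQ hx.
Qed.

(** * Group rings over product groups *)

Section Regroup.
Variables (R : comPzRingType) (A : pzRingType) (gT cT kT : finGroupType).
Variables (r : gT -> cT) (s : cT -> gT) (j : kT -> gT).
Hypotheses (rs : retract r s) (jM : ghom j) (ji : injective j).
Hypothesis jS : forall g, r g = 1%g <-> exists k, j k = g.

Definition coarsen (P : gT -> R -> R) c x := \sum_(g | r g == c) P g x.

Lemma coarsen_hom P g x : grading P -> P g x = x -> coarsen P (r g) x = x.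
Proof.
move=> gP hx; rewrite /coarsen (bigD1 g) //= hx big1 ?addr0 // => h /andP[_ hg].
by rewrite (gr_homE gP h hx) (negPf hg).
Qed.

Lemma grading_coarsen P : grading P -> grading (coarsen P).
Proof.
move=> gP; have [rM sM sK] := rs.
have cD c x y : coarsen P c (x + y) = coarsen P c x + coarsen P c y.
  by rewrite /coarsen -big_split; apply: eq_bigr => g _; rewrite (grD gP).
have Pc g d x : P g (coarsen P d x) = if r g == d then P g x else 0.
  rewrite /coarsen (grS gP); case: eqP => [e|ne].
    rewrite (bigD1 g) ?e //= (grP gP) eqxx big1 ?addr0 // => h /andP[_ hg].
    by rewrite (grP gP) eq_sym (negPf hg).
  rewrite big1 // => h /eqP hd; rewrite (grP gP); case: eqP => // e.
  by rewrite e hd in ne.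
split=> // [c d x|x|c d x y|].
- rewrite {1}/coarsen; under eq_bigr do rewrite Pc.
  case: eqP => [->|cd]; first by apply: eq_bigr => g ->.
  by rewrite big1 // => g /eqP ->; case: eqP.
- by rewrite -[RHS](gr_sum gP) [RHS](partition_big r predT).
- rewrite {2 4}/coarsen mulr_suml (additive_map_sum (cD _)); apply: eq_bigr => g /eqP <-.
  rewrite {2 3}/coarsen mulr_sumr (additive_map_sum (cD _)); apply: eq_bigr => h /eqP <-.
  rewrite -rM; apply: coarsen_hom => //; apply: (gr_homM gP); by rewrite (grP gP) eqxx.
- by rewrite -(ghom1 rM); apply: coarsen_hom => //; apply: gr1.
Qed.

(** This is [A[C x K] = A[K][C]]: the ring [R2] is the degree-one part of the coarsened grading, and
    the section [s] supplies the units for [C]. *)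
Lemma internal_grpring_regroup : internal_grpring R A gT ->
  exists R2 : comPzRingType, internal_grpring R R2 cT /\ internal_grpring R2 A kT.
Proof.
case=> i [P [u [gP uM Pu subA]]]; have [rM sM sK] := rs.
have gC := grading_coarsen gP.
have [|||R2 [i2 sub2]] := @subring_exists R (fun x => coarsen P 1%g x = x).
- exact: (gr1 gC).
- by move=> x y; apply: gr_homB.
- by move=> x y hx hy; have := gr_homM gC hx hy; rewrite mulg1.
exists R2; split.
  exists i2, (coarsen P), (u \o s); split=> //.
    by split=> [x y|] /=; rewrite ?sM ?uM.1 // ghom1 // uM.2.
  by move=> c /=; rewrite -{1}(sK c); apply: coarsen_hom.
have rj k : r (j k) = 1%g by apply/jS; exists k.
apply: (internal_grpring_restrict (iB := i2) (iA := i) (P := fun k => P (j k)) (t := u \o j)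
  sub2 subA).
- move=> x; rewrite (ghom1 jM); split=> [hx|[]//]; split=> //.
  by rewrite -(ghom1 rM); apply: coarsen_hom.
- by move=> k; apply: grD.
- by move=> k l x; rewrite (grP gP) (inj_eq ji).
- move=> x hx; rewrite -[RHS]hx /coarsen.
  have /choice[j' j'E] g : exists k, r g = 1%g -> j k = g.
    have [/jS[k kE]|ne] := pselect (r g = 1%g); first by exists k.
    by exists 1%g.
  rewrite [RHS](reindex_onto j j') => [|g /eqP/j'E//].
  apply: eq_bigl => k; rewrite rj eqxx /=; apply/esym/eqP.
  by apply: ji; rewrite j'E.
- by move=> k l x y; rewrite jM (grM gP).
- by rewrite (ghom1 jM) (gr1 gP).
- move=> k x hx; rewrite -(rj k); apply: coarsen_hom => //; by rewrite (grP gP) eqxx.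
- by split=> [x y|] /=; rewrite ?jM ?uM.1 // ghom1 // uM.2.
- by move=> k /=; rewrite -(rj k); apply: coarsen_hom.
- by move=> k /=.
Qed.
End Regroup.

(** This is [A'[H][G] = A'[G x H]]: take the coefficient [co g] in [A], then its component of degree
    [h]. *)
Lemma internal_grpring_compose (R A : comPzRingType) (A' : pzRingType) (gT hT : finGroupType) :
    internal_grpring R A gT -> internal_grpring A A' hT ->
  internal_grpring R A' (gT * hT)%type.
Proof.
move=> [i [P [u [gP uM Pu [[iD iM i1] ii iS]]]]] [k [Q [v [gQ vM Qv [[kD kM k1] ki kS]]]]].
have i0 := additive_map0 iD.
have /choice[co' coE'] (gr : gT * R) : exists a, i a = P gr.1 gr.2 * u gr.1^-1%g.
  by apply/iS; rewrite -{1}(mulgV gr.1); apply: (gr_homM gP); rewrite ?(grP gP) ?eqxx.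
pose co g r := co' (g, r).
have coE g r : i (co g r) * u g = P g r.
  by rewrite /co coE' /= -mulrA [u _ * u g]mulrC uhomV // mulr1.
have uinj g x y : x * u g = y * u g -> x = y.
  move/(congr1 (fun z => z * u g^-1%g)); by rewrite -!mulrA !uhomV // !mulr1.
have deg g a : P g (i a * u g) = i a * u g.
  by rewrite -{1}[g]mul1g; apply: (gr_homM gP) => //; apply/iS; exists a.
have co_delta g h a : co g (i a * u h) = if g == h then a else 0.
  apply: ii; apply: (uinj g); rewrite coE (gr_homE gP g (deg h a)).
  by case: eqP => [->//|_]; rewrite i0 mul0r.
have coD g x y : co g (x + y) = co g x + co g y.
  by apply: ii; apply: (uinj g); rewrite iD mulrDl !coE (grD gP).
pose T (gh : (gT * hT)%type) x := i (Q gh.2 (co gh.1 x)) * u gh.1.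
have TD gh x y : T gh (x + y) = T gh x + T gh y.
  by rewrite /T coD (grD gQ) iD mulrDl.
have Tdelta gh g a : T gh (i a * u g) = if gh.1 == g then i (Q gh.2 a) * u g else 0.
  by rewrite /T co_delta; case: eqP => [->//|_]; rewrite (gr0 gQ) i0 mul0r.
exists (i \o k), T, (fun gh : (gT * hT)%type => u gh.1 * i (v gh.2)); split.
- split=> // [[g h] [g' h'] x|x|[g h] [g' h'] x y|].
  + rewrite {2}/T Tdelta /= (grP gQ) xpair_eqE /=.
    case: eqP => //= _; rewrite /T /=; case: eqP => // _; by rewrite i0 mul0r.
  + rewrite -(pair_big predT predT (fun g h => T (g, h) x)) /= -[RHS](gr_sum gP).
    apply: eq_bigr => g _; rewrite -(coE g x) -{1}(gr_sum gQ (co g x)).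
    by rewrite (additive_map_sum iD) mulr_suml.
  + have -> : T (g, h) x * T (g', h') y = i (Q h (co g x) * Q h' (co g' y)) * u (g * g')%g.
      by rewrite /T /= mulrACA -iM -uM.1.
    by rewrite Tdelta /= eqxx (grM gQ).
  + by rewrite -{1}[1]mulr1 -{1}i1 -uM.2 Tdelta /= eqxx (gr1 gQ) i1 uM.2 mulr1.
- split=> [[g h] [g' h']|] /=; last by rewrite uM.2 vM.2 i1 mulr1.
  by rewrite uM.1 vM.1 iM mulrACA.
- by move=> [g h]; rewrite /= mulrC Tdelta /= eqxx Qv.
- split.
  + by split=> [x y|x y|] /=; rewrite ?kD ?kM ?k1.
  + exact: inj_comp.
  + move=> x; have TE : T 1%g x = i (Q 1%g (co 1%g x)) by rewrite /T /= uM.2 mulr1.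
    rewrite TE; split=> [e|[a <-]].
      have [a aE] : exists a, k a = Q 1%g (co 1%g x) by apply/kS; rewrite (grP gQ) eqxx.
      by exists a; rewrite /= aE.
    have := Tdelta 1%g 1%g (k a); rewrite /= eqxx uM.2 !mulr1 /T /= uM.2 mulr1 => ->.
    by congr i; apply/kS; exists a.
Qed.

(** * Existence and uniqueness *)

Definition nonzero_reduced_order (R : comPzRingType) : Prop :=
  [/\ is_order R, reduced R & (1 : R) != 0].

(** The degree-one projection is an additive retraction of [R] onto [A], so [A] is again a
    lattice. *)
Lemma nonzero_reduced_order_coefficients (R A : comPzRingType) (gT : finGroupType) :
  nonzero_reduced_order R -> internal_grpring R A gT -> nonzero_reduced_order A.
Proof.
case=> Rord Rred R1 [i [P [u [gP _ _ [[iD iM i1] ii iS]]]]].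
have i0 := additive_map0 iD.
have /choice[s sE] x : exists a, i a = P 1%g x by apply/iS; rewrite (grP gP) eqxx.
split.
- apply: (is_order_retract (i := i) (s := s) Rord iD).
    by move=> x y; apply: ii; rewrite iD !sE (grD gP).
  by move=> a; apply: ii; rewrite sE; apply/iS; exists a.
- move=> x n xn; apply: ii; rewrite i0; apply: (Rred _ n).
  have <- : i (x ^+ n) = i x ^+ n by elim: n {xn} => [|n IH]; rewrite ?expr0 // !exprS iM IH.
  by rewrite xn i0.
- by apply: contra R1 => /eqP A1; rewrite -i1 A1 i0.
Qed.

(** Commutativity of [A] comes from its embedding in [R], finiteness of the group from the rank.
    This brings an arbitrary decomposition into the internal form. *)
Lemma grpring_iso_internal (R : comPzRingType) (A : pzRingType) (G : grp) :
    nonzero_reduced_order R -> grpring_iso R A G ->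
  exists (A' : comPzRingType) (gT : finGroupType),
    [/\ (A' : pzRingType) = A, commutative (@mulg gT), grp_iso G (grp_of gT),
        fin_abelian G & internal_grpring R A' gT].
Proof.
case=> Rord Rred R1 RAG; have [phi phiP] := RAG.
have GA : fin_abelian G := grpring_finite_abelian phiP (@mulrC R) R1 Rord.
have [gT [cG Gg]] := fin_abelian_finGroup GA.
have RA : internal_grpring R A gT.
  by apply/internal_grpringP; apply: grpring_iso_grp RAG; apply: grp_iso_sym.
have mC : commutative (@GRing.mul A).
  have [i [P [u [_ _ _ [[_ iM _] ii _]]]]] := RA.
  by move=> x y; apply: ii; rewrite !iM mulrC.
by exists (com_pzRing mC), gT; split=> //; rewrite com_pzRingE.
Qed.

Lemma grp_iso_nontrivial (G H : grp) : grp_iso G H -> grp_nontrivial G -> grp_nontrivial H.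
Proof.
case=> f [fb fM] [g g1]; have [h fK hK] := fb.
have f1 : f gone = gone.
  by rewrite -[LHS](@gmul1 H) -(@gmulV H (f gone)) -gmulA -fM gmul1 gmulV.
by exists (f g) => e; apply: g1; apply: (can_inj fK); rewrite e f1.
Qed.

Lemma internal_grpring_trivial (R : comPzRingType) (A : pzRingType) (gT : finGroupType) :
  (#|gT| <= 1)%N -> internal_grpring R A gT -> ring_iso A R.
Proof.
move=> g1 [i [P [u [gP _ _ [[iD iM i1] ii iS]]]]].
exists i; split=> //; apply: inj_surj_bijective => // x; apply/iS.
rewrite -[RHS](gr_sum gP) (bigD1 1%g) //= big1 ?addr0 // => g.
by rewrite (card_le1_eq1 g g1) eqxx.
Qed.

(** Split off an indecomposable factor [C], so that [R = R2[C]] and [R2 = A[K]]. As [B] is stark,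
    exchange makes [C] a factor of the other group: [R = R2'[C]], [R2' = B[L]]. Cancellation
    identifies [R2] with [R2'], and induction applies to the smaller [K]. *)
Lemma stark_coefficients_unique (R A B : comPzRingType) (gT hT : finGroupType) :
    nonzero_reduced_order R -> commutative (@mulg gT) -> commutative (@mulg hT) ->
    stark A -> stark B -> internal_grpring R A gT -> internal_grpring R B hT ->
  ring_iso B A /\ grp_iso (grp_of hT) (grp_of gT).
Proof.
have [n] := ubnP #|gT|; elim: n => // n IH in R A B gT hT *; rewrite ltnS => gn.
move=> Rgood cG cH sA sB RA RB; have [Rord Rred R1] := Rgood.
have [g1|g1] := leqP #|gT| 1.
  have AR := internal_grpring_trivial g1 RA.
  (* Here [A] is isomorphic to [R], a group ring over [B], so starkness of [A] forces the other
     group to be trivial. *)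
  have h1 : (#|hT| <= 1)%N.
    rewrite leqNgt; apply/negP => h1; apply: sA; exists B, (grp_of hT).
    split; first exact/card_gt1_nontrivial.
    by apply: (grpring_iso_ring AR); apply/internal_grpringP.
  have BR := internal_grpring_trivial h1 RB.
  split; first exact: ring_iso_trans BR (ring_iso_sym AR).
  apply: (@grp_iso_ghom _ _ (fun=> 1%g)); first by move=> x y; rewrite mulg1.
  by exists (fun=> 1%g) => x; rewrite [RHS]card_le1_eq1.
have [cT [r [s [rs lC cC c1]]]] := local_retract cG g1.
have [kT [j [jM ji jS cK gTE]]] := retract_product cG rs.
have [R2 [RR2 R2A]] := internal_grpring_regroup rs jM ji jS RA.
have [i2 [P [u [gP uM Pu sub2]]]] := RR2.
have [iB [Q [v [gQ vM Qv subB]]]] := RB.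
have [[a [b [aM bM abi]]]|[t [tM Qt Pt]]] :=
  exchange Rord Rred R1 lC cC cH gP gQ uM vM Pu Qv; last first.
  case: (not_stark_of_units gP gQ _ subB c1 tM Qt Pt sB).
  exact: gradings_commute.
have abM : ghom (b \o a) by move=> x y; rewrite /= aM bM.
(* Correcting [b] by the inverse of [b \o a] gives a retraction onto [C] with section [a]. *)
have [d [dM da ad]] := inj_endo_bij erefl abM abi.
have rs' : retract (d \o b) a.
  by split=> // x y /=; rewrite bM dM.
have [lT [j' [j'M j'i j'S cL hTE]]] := retract_product cH rs'.
have [R2' [RR2' R2'B]] := internal_grpring_regroup rs' j'M j'i j'S RB.
have [i2' [P' [u' [gP' uM' Pu' sub2']]]] := RR2'.
have iso2 : ring_iso R2 R2' := cancellation Rord Rred R1 lC cC gP gP' uM uM' Pu Pu' sub2 sub2'.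
have R2B : internal_grpring R2 B lT.
  by apply/internal_grpringP; apply: grpring_iso_ring iso2 _; apply/internal_grpringP.
have kn : (#|kT| < n)%N.
  apply: leq_trans _ gn; have [f [fb _]] := gTE.
  rewrite -(bij_eq_card fb) card_prod ltn_Pmull //.
  by apply/card_gt0P; exists 1%g.
have R2good := nonzero_reduced_order_coefficients Rgood RR2.
have [BA lk] := IH R2 A B kT lT kn R2good cK cL sA sB R2A R2B.
split=> //; apply: grp_iso_trans (grp_iso_sym hTE) _.
by apply: grp_iso_trans gTE; apply: grp_iso_prod.
Qed.

(** Starting from [R] over the trivial group, a coefficient ring that is not stark is decomposed
    further. This enlarges the group, whose order stays at most the rank [n]. *)
Lemma stark_coefficients_exist (R : comPzRingType) : nonzero_reduced_order R ->
  exists (A : comPzRingType) (gT : finGroupType),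
    [/\ stark A, commutative (@mulg gT) & internal_grpring R A gT].
Proof.
move=> Rgood; have [[n [f [fbij fD]]] Rred R1] := Rgood.
suff ext d (A : comPzRingType) (gT : finGroupType) :
    commutative (@mulg gT) -> internal_grpring R A gT -> (n - #|gT| < d)%N ->
    exists (A : comPzRingType) (gT : finGroupType),
    [/\ stark A, commutative (@mulg gT) & internal_grpring R A gT].
  (* The permutations of the empty set serve as the trivial group. *)
  have triv (x : {perm 'I_0}) : x = 1%g by apply/permP => -[].
  apply: (ext _ R {perm 'I_0}) (ltnSn _); first by move=> x y; rewrite [x]triv [y]triv.
  exists id, (fun _ x => x), (fun=> 1); split=> //.
  - split=> // [g h x|x]; first by rewrite [g]triv [h]triv eqxx.
    by rewrite (bigD1 1%g) //= big1 ?addr0 // => g; rewrite [g]triv eqxx.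
  - by split=> // x y; rewrite mulr1.
  - by split=> // x; split=> [_|//]; exists x.
elim: d => // d IH in A gT * => cG RA; rewrite ltnS => nd.
have [sA|] := pselect (stark A); first by exists A, gT.
move/contrapT => [A0 [G [Gnt AG]]].
have Agood := nonzero_reduced_order_coefficients Rgood RA.
have [A' [hT [A'E cH GH _ AA']]] := grpring_iso_internal Agood AG.
have RA' := internal_grpring_compose RA AA'.
have cGH : commutative (@mulg (gT * hT)%type).
  by move=> [x y] [x' y']; exact: (congr2 pair (cG x x') (cH y y')).
apply: (IH A' _ cGH RA').
have [phi phiP] : grpring_iso R A' (grp_of (gT * hT)%type) by apply/internal_grpringP.
have le_n : (#|{: gT * hT}| <= n)%N.
  by rewrite cardE; apply: (grpring_bound phiP R1 fbij fD); apply/ListNoDupP/enum_uniq.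
rewrite card_prod in le_n.
have h1 : (1 < #|hT|)%N by apply/card_gt1_nontrivial; apply: grp_iso_nontrivial GH Gnt.
have g0 : (0 < #|gT|)%N by apply/card_gt0P; exists 1%g.
have lt_gh : (#|gT| < #|gT| * #|hT|)%N by rewrite ltn_Pmulr.
rewrite card_prod; apply: leq_trans nd.
exact: ltn_sub2l (leq_trans lt_gh le_n) lt_gh.
Qed.

Theorem theorem1p2 (R : comPzRingType) :
  is_order R -> reduced R -> (1 : R) != 0 ->
  exists (A : pzRingType) (G : grp),
    [/\ stark A, fin_abelian G, grpring_iso R A G &
        forall (B : pzRingType) (H : grp),
          stark B -> fin_abelian H -> grpring_iso R B H ->
          ring_iso B A /\ grp_iso H G].
Proof.
move=> Rord Rred R1; have Rgood : nonzero_reduced_order R by [].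
have [A [gT [sA cG RA]]] := stark_coefficients_exist Rgood.
exists A, (grp_of gT); split=> //; [|exact/internal_grpringP|].
  by split; [exists (enum gT) => g; apply/ListInP; rewrite mem_enum | exact: cG].
move=> B H sB _ RBH.
have [B' [hT [B'E cH HH _ RB]]] := grpring_iso_internal Rgood RBH.
(* The equation replaces [B] by its commutative version. *)
subst B; have [BA hg] := stark_coefficients_unique Rgood cG cH sA sB RA RB.
by split=> //; apply: grp_iso_trans HH hg.
Qed.
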